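(* Let $\Omega$ be a countably infinite set, $S=\mathrm{Sym}(\Omega)$, and let $\mathcal Q$ be the set of partitions $A$ of $\Omega$ for which there is a common finite bound on the cardinalities of the members of $A$ and such that infinitely many members of $A$ have cardinality $>1$. Then the subgroups $S_{(A)}$ with $A\in\mathcal Q$ are mutually $\approx$-equivalent, and a closed subgroup $G\le S$ is $\approx$-equivalent to these subgroups if and only if there exist a finite subset $\Gamma\subseteq\Omega$ and a positive integer $n$ such that all orbits of $G_{(\Gamma)}$ have cardinality at most $n$, but there is no finite $\Gamma\subseteq\Omega$ with $G_{(\Gamma)}=\{1\}$. Moreover, if $A\in\mathcal Q$ and $B$ is a partition of $\Omega$ into finite subsets with no common finite bound on the cardinalities of its members, then $S_{(A)}\prec S_{(B)}$.
   Context: $\mathrm{Sym}(\Omega)$ is the group of all permutations of $\Omega$ (acting on the right). $S$ carries the function topology (pointwise convergence, $\Omega$ discrete); ''closed'' means closed in $S$. For a partition $A$ of $\Omega$, $S_{(A)}=\{f\in S:\Sigma f=\Sigma\text{ for all }\Sigma\in A\}$. For $G\le S$ and $\Gamma\subseteq\Omega$, $G_{(\Gamma)}$ is the pointwise stabilizer of $\Gamma$ in $G$. For subgroups $G_1,G_2\le S$: $G_1\preccurlyeq G_2$ means there is a finite $U\subseteq S$ with $G_1\le\langle G_2\cup U\rangle$; $G_1\approx G_2$ means $G_1\preccurlyeq G_2$ and $G_2\preccurlyeq G_1$; $G_1\prec G_2$ means $G_1\preccurlyeq G_2$ and not $G_2\preccurlyeq G_1$. *)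

(* Defs.v *)
From Stdlib Require Import List Arith.
Import ListNotations.
Set Implicit Arguments.

Definition countably_infinite (T : Type) : Prop :=
  exists f : nat -> T, (forall m n, f m = f n -> m = n) /\ (forall x, exists n, f n = x).

Record perm (T : Type) := Perm {
  pf : T -> T;
  pinv : T -> T;
  pinvK : forall x, pinv (pf x) = x;
  pfK : forall x, pf (pinv x) = x }.
Arguments pf {T} p x.

Definition perm_id (T : Type) : perm T :=
  @Perm T (fun x => x) (fun x => x) (fun _ => eq_refl) (fun _ => eq_refl).

(* right action: x^(f*g) = (x^f)^g *)
Definition perm_mul (T : Type) (f g : perm T) : perm T.
Proof.
  refine (@Perm T (fun x => pf g (pf f x)) (fun x => pinv f (pinv g x)) _ _).
  - intro x. rewrite pinvK. apply pinvK.
  - intro x. rewrite pfK. apply pfK.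
Defined.

Definition perm_inv (T : Type) (f : perm T) : perm T :=
  @Perm T (pinv f) (pf f) (pfK f) (pinvK f).

Definition is_subgroup (T : Type) (G : perm T -> Prop) : Prop :=
  G (perm_id T) /\ (forall f g, G f -> G g -> G (perm_mul f g)) /\
  (forall f, G f -> G (perm_inv f)).

Inductive generated (T : Type) (X : perm T -> Prop) : perm T -> Prop :=
| gen_base : forall f, X f -> generated X f
| gen_id : generated X (perm_id T)
| gen_mul : forall f g, generated X f -> generated X g -> generated X (perm_mul f g)
| gen_inv : forall f, generated X f -> generated X (perm_inv f).

(* Closed in the topology of pointwise convergence (Omega discrete). *)
Definition closed_sub (T : Type) (G : perm T -> Prop) : Prop :=
  forall h : perm T,
    (forall F : list T, exists g, G g /\ forall x, In x F -> pf g x = pf h x) -> G h.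

Definition preceq (T : Type) (G1 G2 : perm T -> Prop) : Prop :=
  exists U : list (perm T), forall g, G1 g -> generated (fun h => G2 h \/ In h U) g.

Definition approx (T : Type) (G1 G2 : perm T -> Prop) : Prop :=
  preceq G1 G2 /\ preceq G2 G1.

Definition prec (T : Type) (G1 G2 : perm T -> Prop) : Prop :=
  preceq G1 G2 /\ ~ preceq G2 G1.

Definition finite_set (X : Type) (P : X -> Prop) : Prop :=
  exists l : list X, forall x, P x -> In x l.

Definition card_le (X : Type) (P : X -> Prop) (n : nat) : Prop :=
  exists l : list X, length l <= n /\ forall x, P x -> In x l.

Definition card_gt1 (X : Type) (P : X -> Prop) : Prop :=
  exists x y, x <> y /\ P x /\ P y.

Definition is_partition (T : Type) (A : (T -> Prop) -> Prop) : Prop :=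
  (forall Sg, A Sg -> exists x, Sg x) /\
  (forall Sg Sg', A Sg -> A Sg' -> (exists x, Sg x /\ Sg' x) -> Sg = Sg') /\
  (forall x, exists Sg, A Sg /\ Sg x).

Definition bounded_partition (T : Type) (A : (T -> Prop) -> Prop) : Prop :=
  exists n, forall Sg, A Sg -> card_le Sg n.

Definition in_Q (T : Type) (A : (T -> Prop) -> Prop) : Prop :=
  is_partition A /\ bounded_partition A /\
  ~ finite_set (fun Sg => A Sg /\ card_gt1 Sg).

Definition stab_partition (T : Type) (A : (T -> Prop) -> Prop) : perm T -> Prop :=
  fun f => forall Sg, A Sg ->
    (forall x, Sg x -> Sg (pf f x)) /\ (forall y, Sg y -> exists x, Sg x /\ pf f x = y).

Definition ptwise_stab (T : Type) (G : perm T -> Prop) (Gamma : list T) : perm T -> Prop :=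
  fun g => G g /\ forall x, In x Gamma -> pf g x = x.

Definition orbit (T : Type) (H : perm T -> Prop) (x : T) : T -> Prop :=
  fun y => exists h, H h /\ pf h x = y.

(* Main.v *)
Require Import Defs.
From Stdlib Require Import List Arith Lia ZArith Cantor.
From Stdlib Require Import Classical ClassicalEpsilon FunctionalExtensionality.
From Stdlib Require Import PropExtensionality ProofIrrelevance.
From Stdlib Require Import ssreflect ssrfun.
Import ListNotations.
Set Implicit Arguments.
Set Bullet Behavior "None".

(** All groups are compared with the elementary abelian 2-group [pair_group p] of
all products of the disjoint transpositions [(p(i,false) p(i,true))], where the
pairs leave infinitely many points fixed; these groups are all conjugate.

Upper bounds. A permutation preserving classes of size at most [n] is a product of
boundedly many involutions, each swapping the points of two given ranks in some of
the classes, so it lies in a product of conjugates of a pair group. A group [G] is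
reduced to a pointwise stabilizer by Galvin's theorem that a countable set of
permutations lies in a finitely generated group.

Lower bounds. If [G] has points [x_i], [y_i] such that each choice of [x_i] or [y_i]
is the image of the sequence [x_i] under some element of [G], a commutator argument
recovers the pair group from [G] and two permutations. For a closed [G] whose
stabilizers have bounded orbits and are never trivial, such points are found by
minimizing the bound on the orbits.

Necessity. An element of the group generated by a pair group and a finite set is a
word whose length bounds the number of images of each point, and a Baire category
argument makes this bound uniform on a stabilizer of [G]. A group with a trivial
stabilizer is countable, while pair groups are not. *)

(** * Choice principles *)

Lemma choice_fun (A B : Type) (R : A -> B -> Prop) :
  (forall x, exists y, R x y) -> exists f, forall x, R x (f x).
Proof.
move=> h.
exists (fun x => proj1_sig (constructive_indefinite_description _ (h x))) => x.
by case: constructive_indefinite_description.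
Qed.

Lemma dependent_choice (S : Type) (I : S -> Prop) (R : nat -> S -> S -> Prop) s0 :
  I s0 -> (forall n s, I s -> exists s', I s' /\ R n s s') ->
  exists f : nat -> S, f 0 = s0 /\ forall n, I (f n) /\ R n (f n) (f (Datatypes.S n)).
Proof.
move=> h0 h.
have [step hstep] : exists step : nat * S -> S, forall p, I (snd p) ->
    I (step p) /\ R (fst p) (snd p) (step p).
  apply: (@choice_fun _ _ (fun p s => I (snd p) -> I s /\ R (fst p) (snd p) s)) => - [n s] /=.
  (* Outside [I] the step returns its own state, a default that makes it total. *)
  case: (classic (I s)) => hs; last by exists s.
  by have [s' hs'] := h n s hs; exists s'.
pose f := nat_rect (fun _ => S) s0 (fun n s => step (n, s)).
have hI n : I (f n).
  elim: n => [//|n IH]; exact: (proj1 (hstep (n, f n) IH)).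
exists f; split=> // n; split=> //; exact: (proj2 (hstep (n, f n) (hI n))).
Qed.

(** * Permutations, generated subgroups and the preorder *)

Section Permutations.

Variable T : Type.
Implicit Types (f g h t u : perm T) (x y z : T) (G H : perm T -> Prop).

Lemma perm_ext f g : (forall x, pf f x = pf g x) -> f = g.
Proof.
case: f g => [f f' fK f'K] [g g' gK g'K] /= e.
have ef : f = g by apply: functional_extensionality.
have ef' : f' = g'.
  apply: functional_extensionality => x.
  by rewrite -{1}(g'K x) -e fK.
by subst; f_equal; apply: proof_irrelevance.
Qed.

Lemma pf_inj f x y : pf f x = pf f y -> x = y.
Proof. by move=> e; rewrite -(pinvK f x) e pinvK. Qed.

Definition conj_perm (u t : perm T) : perm T :=
  perm_mul (perm_mul (perm_inv u) t) u.

Lemma pf_conj u t x : pf (conj_perm u t) (pf u x) = pf u (pf t x).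
Proof. by rewrite /= pinvK. Qed.

Lemma conj_permK u t : conj_perm u (conj_perm (perm_inv u) t) = t.
Proof. by apply: perm_ext => x /=; rewrite !pfK. Qed.

Lemma perm_of_bij (f : T -> T) : injective f -> (forall y, exists x, f x = y) ->
  exists u : perm T, forall x, pf u x = f x.
Proof.
move=> fI /choice_fun [f' fK].
have f'K x : f' (f x) = x by apply: fI.
by exists (@Perm T f f' f'K fK).
Qed.

Lemma perm_of_inj_family X (r s : X -> T) :
  injective r -> injective s -> (forall x, exists q, r q = x) ->
  (forall x, exists q, s q = x) -> exists u, forall q, pf u (r q) = s q.
Proof.
move=> rI sI /choice_fun [r' rK] sS.
have r'K q : r' (r q) = q by apply: rI.
have [||u hu] := @perm_of_bij (fun x => s (r' x)).
- by move=> x y /sI e; rewrite -(rK x) e rK.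
- by move=> y; have [q <-] := sS y; exists (r q); rewrite r'K.
by exists u => q; rewrite hu r'K.
Qed.

(** The permutations [u], [W], [a] and [V] of the commutator arguments arise this way: they are
    described on an index set with convenient coordinates and are trivial off its image. *)
Lemma extend_perm X (r : X -> T) (phi phi' : X -> X) :
  injective r -> cancel phi phi' -> cancel phi' phi ->
  exists u, (forall q, pf u (r q) = r (phi q)) /\
            (forall x, (forall q, r q <> x) -> pf u x = x).
Proof.
move=> rI phiK phi'K.
have [f hf] : exists f : T -> T, forall x, (forall q, r q = x -> f x = r (phi q)) /\
    ((forall q, r q <> x) -> f x = x).
  apply: (@choice_fun _ _ (fun x y => (forall q, r q = x -> y = r (phi q)) /\
    ((forall q, r q <> x) -> y = x))) => x.
  case: (classic (exists q, r q = x)) => [[q <-]|hq].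
    exists (r (phi q)); split; first by move=> q' /rI ->.
    by move=> /(_ q).
  exists x; split=> // q e; case: hq; by exists q.
have fr q : f (r q) = r (phi q) by exact: (proj1 (hf (r q))).
have fo x : (forall q, r q <> x) -> f x = x by exact: (proj2 (hf x)).
have cl x : (exists q, x = r q) \/ (forall q, r q <> x).
  case: (classic (exists q, x = r q)) => hq; [by left|right=> q e].
  by apply: hq; exists q.
have [||u hu] := @perm_of_bij f.
- move=> x y; case: (cl x) => [[q ->]|hx]; case: (cl y) => [[q' ->]|hy].
  + by rewrite !fr => /rI e; rewrite -(phiK q) e phiK.
  + by rewrite fr fo // => e; case: (hy (phi q)).
  + by rewrite fr fo // => e; case: (hx (phi q')).
  + by rewrite !fo.
- move=> y; case: (cl y) => [[q ->]|hy]; last by exists y; rewrite fo.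
  by exists (r (phi' q)); rewrite fr phi'K.
by exists u; split=> [q|x hx]; rewrite hu ?fr ?fo.
Qed.

Lemma generated_bind (X Y : perm T -> Prop) g :
  (forall f, X f -> generated Y f) -> generated X g -> generated Y g.
Proof.
by move=> h; elim=> [f /h //||f1 f2 _ h1 _ h2|f1 _ h1];
  [exact: gen_id | exact: gen_mul | exact: gen_inv].
Qed.

Lemma generated_mono (X Y : perm T -> Prop) g :
  (forall f, X f -> Y f) -> generated X g -> generated Y g.
Proof. by move=> h; apply: generated_bind => f /h; exact: gen_base. Qed.

Lemma generated_conj (X : perm T -> Prop) u t :
  generated X u -> generated X t -> generated X (conj_perm u t).
Proof. by move=> hu ht; apply: gen_mul => //; apply: gen_mul => //; apply: gen_inv. Qed.

Lemma preceq_sub G H : (forall g, G g -> H g) -> preceq G H.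
Proof. by move=> h; exists [] => g /h hg; apply: gen_base; left. Qed.

Lemma preceq_trans G H K : preceq G H -> preceq H K -> preceq G K.
Proof.
move=> [U hU] [V hV]; exists (U ++ V) => g /hU.
apply: generated_bind => f [/hV|hf].
  apply: generated_mono => k [?|?]; [by left|right; apply/in_or_app; by right].
by apply: gen_base; right; apply/in_or_app; left.
Qed.

Lemma preceq_union (I : Type) (l : list I) (F : I -> perm T -> Prop) H :
  (forall i, In i l -> preceq (F i) H) ->
  preceq (fun g => exists i, In i l /\ F i g) H.
Proof.
elim: l => [|i l IH] h; first by exists [] => g [i []].
have [|U hU] := h i; first by left.
have [|V hV] := IH; first by move=> j hj; apply: h; right.
exists (U ++ V) => g [j [[<- /hU|hj hF]]].
  apply: generated_mono => k [?|?]; [by left|right; apply/in_or_app; by left].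
have: generated (fun h => H h \/ In h V) g by apply: hV; exists j.
apply: generated_mono => k [?|?]; [by left|right; apply/in_or_app; by right].
Qed.

Lemma preceq_generated G H :
  preceq G H -> preceq (generated G) H.
Proof. by move=> [U hU]; exists U => g; apply: generated_bind. Qed.

Lemma finite_set_list (P : T -> Prop) : finite_set P -> exists l, forall x, In x l <-> P x.
Proof.
move=> [l]; elim: l P => [|a l IH] P h; first by exists [] => x; split=> // /h [].
have [|l' hl'] := IH (fun x => P x /\ x <> a).
  by move=> x [/h [->|//]] [].
case: (classic (P a)) => ha.
  exists (a :: l') => x; split=> [[<- //|/hl' []//]|hx].
  case: (classic (x = a)) => [->|ne]; [by left|right]; exact/hl'.
exists l' => x; rewrite hl'; split=> [[]//|hx]; split=> // e; apply: ha; by rewrite -e.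
Qed.

Lemma finite_set_or (P Q : T -> Prop) :
  finite_set P -> finite_set Q -> finite_set (fun x => P x \/ Q x).
Proof.
by move=> [l hl] [l' hl']; exists (l ++ l') => x h; apply/in_or_app; case: h => [/hl|/hl']; [left|right].
Qed.

Lemma infinite_of_seq (P : T -> Prop) (e : nat -> T) :
  injective e -> (forall n, P (e n)) -> ~ finite_set P.
Proof.
move=> eI eP [l hl].
have hnd : NoDup (map e (seq 0 (S (length l)))).
  apply: NoDup_map_NoDup_ForallPairs (seq_NoDup _ _) => x y _ _; exact: eI.
have := NoDup_incl_length hnd (l' := l); rewrite length_map length_seq => h.
have: S (length l) <= length l; last by lia.
by apply: h => x /in_map_iff [n [<- _]]; apply: hl.
Qed.

Lemma infinite_avoid (P : T -> Prop) (l : list T) :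
  ~ finite_set P -> exists x, P x /\ ~ In x l.
Proof.
move=> h; apply: NNPP => h'; apply: h; exists l => x hx.
by apply: NNPP => hl; apply: h'; exists x.
Qed.

(** The room outside the range is what allows injective families to be carried to each other by a
    permutation of [T]. *)
Definition coinfinite X (r : X -> T) := ~ finite_set (fun x => forall q, r q <> x).

Lemma coinfinite_of_seq X (r : X -> T) (e : nat -> T) :
  injective e -> (forall n q, r q <> e n) -> coinfinite r.
Proof. by move=> eI h; apply: (infinite_of_seq (e := e)). Qed.

End Permutations.

(** * Enumerations of infinite subsets and extension of injections *)

Section Countable.

Variables (T : Type) (nu : nat -> T) (idx : T -> nat).
Hypotheses (nuK : cancel nu idx) (idxK : cancel idx nu).
Implicit Types (f g h t u : perm T) (x y z : T) (G H : perm T -> Prop).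

Lemma infinite_carrier : ~ finite_set (fun _ : T => True).
Proof. by apply: (infinite_of_seq (e := nu)) => //; apply: (can_inj nuK). Qed.

Lemma enum_infinite (P : T -> Prop) : ~ finite_set P ->
  exists e : nat -> T, injective e /\ forall x, P x <-> exists n, e n = x.
Proof.
move=> infP.
(* The indices of [P] are listed in increasing order: [n] is the first one at or after [m]. *)
have unb m : exists n, m <= n /\ P (nu n) /\ forall k, m <= k -> k < n -> ~ P (nu k).
  have [x [Px nx]] := infinite_avoid (map nu (seq 0 m)) infP.
  have hx : m <= idx x.
    apply: NNPP => lt; apply: nx; apply/in_map_iff; exists (idx x); split=> //.
    apply/in_seq; lia.
  move: (idx x) hx (idxK x) => n; elim/lt_wf_ind: n x Px {nx} => n IH x Px hx ex.
  case: (classic (exists k, m <= k /\ k < n /\ P (nu k))) => [[k [h1 [h2 h3]]]|hk].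
    by apply: (IH k h2 (nu k) h3 h1).
  exists n; rewrite ex; split=> //; split=> // k h1 h2 h3; apply: hk; by exists k.
have [nx hnx] := choice_fun _ unb.
pose e := nat_rect (fun _ => nat) (nx 0) (fun _ k => nx (S k)).
have eS k : e (S k) = nx (S (e k)) by [].
have lt1 k : e k < e (S k) by rewrite eS; have := proj1 (hnx (S (e k))); lia.
have lt i j : i < j -> e i < e j.
  elim: j => [|j IH] hij; first lia.
  case: (Nat.eq_dec i j) => [->|ne]; first exact: lt1.
  apply: Nat.lt_trans (lt1 j); apply: IH; lia.
have ge k : k <= e k by elim: k => [|k IH]; [lia|have := lt1 k; lia].
have eP k : P (nu (e k)).
  case: k => [|k]; first exact: (proj1 (proj2 (hnx 0))).
  by rewrite eS; apply: (proj1 (proj2 (hnx _))).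
exists (fun k => nu (e k)); split.
  move=> i j /(can_inj nuK) eij.
  case: (lt_eq_lt_dec i j) => [[/lt|//]|/lt]; lia.
move=> x; split=> [Px|[n <-] //].
(* No index of [P] is skipped, so either [x] is listed or [e k] has not passed it. The latter fails
   for [k = S (idx x)] because [k <= e k]. *)
have key k : (exists i, e i = idx x) \/ e k <= idx x.
  elim: k => [|k [IH|IH]]; [right|by left|].
    apply: NNPP => h; apply: (proj2 (proj2 (hnx 0)) (idx x)); rewrite ?idxK //; [lia|].
    by move: h; rewrite /e /=; lia.
  case: (Nat.eq_dec (e k) (idx x)) => [?|ne]; first by left; exists k.
  right; apply: NNPP => h; apply: (proj2 (proj2 (hnx (S (e k)))) (idx x)); rewrite ?idxK //; [lia|].
  move: h; rewrite eS; lia.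
case: (key (S (idx x))) => [[i ei]|h]; first by exists i; rewrite ei idxK.
have := ge (S (idx x)); lia.
Qed.

(** Both complements are countably infinite, so their enumerations match them point by point. *)
Lemma perm_extending X (r s : X -> T) :
  injective r -> injective s -> coinfinite r -> coinfinite s ->
  exists u, forall q, pf u (r q) = s q.
Proof.
move=> rI sI /enum_infinite [e [eI eP]] /enum_infinite [d [dI dP]].
pose R (q : X + nat) := match q with inl q => r q | inr n => e n end.
pose D (q : X + nat) := match q with inl q => s q | inr n => d n end.
have ne q n : r q <> e n by apply: (proj2 (eP (e n))); exists n.
have nd q n : s q <> d n by apply: (proj2 (dP (d n))); exists n.
have [||||u hu] := @perm_of_inj_family T _ R D.
- move=> [q|n] [q'|n'] /=; [by move/rI->|by move/ne|by move/esym/ne|by move/eI->].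
- move=> [q|n] [q'|n'] /=; [by move/sI->|by move/nd|by move/esym/nd|by move/dI->].
- move=> x; case: (classic (forall q, r q <> x)) => [/eP [n <-]|h]; first by exists (inr n).
  by have [q /NNPP hq] := not_all_ex_not _ _ h; exists (inl q).
- move=> x; case: (classic (forall q, s q <> x)) => [/dP [n <-]|h]; first by exists (inr n).
  by have [q /NNPP hq] := not_all_ex_not _ _ h; exists (inl q).
by exists u => q; apply: (hu (inl q)).
Qed.

(** * Pair groups and bounded classes *)

Definition pair_group (p : nat * bool -> T) (t : perm T) : Prop :=
  (forall i, (forall b, pf t (p (i, b)) = p (i, b)) \/
             (forall b, pf t (p (i, b)) = p (i, negb b))) /\
  (forall x, (forall q, p q <> x) -> pf t x = x).

Lemma pair_group_conj p p' u t : (forall q, pf u (p' q) = p q) ->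
  pair_group p t -> pair_group p' (conj_perm (perm_inv u) t).
Proof.
move=> hu [h1 h2]; split=> [i|x hx] /=.
  by case: (h1 i) => h; [left|right] => b; rewrite hu h -hu pinvK.
rewrite h2 ?pinvK // => q e; apply: (hx q); apply: (@pf_inj _ u); by rewrite hu.
Qed.

Lemma pair_group_preceq p p' :
  injective p -> coinfinite p -> injective p' -> coinfinite p' ->
  preceq (pair_group p) (pair_group p').
Proof.
move=> pI pC p'I p'C; have [u hu] := perm_extending p'I pI p'C pC.
exists [u] => t ht; rewrite -(conj_permK u t).
apply: generated_conj; apply: gen_base; first by right; left.
by left; apply: pair_group_conj ht.
Qed.

Lemma pair_group_perm p (eps : nat -> bool) : injective p ->
  exists t, (forall i b, pf t (p (i, b)) = p (i, xorb (eps i) b)) /\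
            (forall x, (forall q, p q <> x) -> pf t x = x).
Proof.
move=> pI; pose phi (q : nat * bool) := (fst q, xorb (eps (fst q)) (snd q)).
have phiK : cancel phi phi.
  by move=> [i b]; rewrite /phi /=; case: (eps i); case: b.
by have [t [h1 h2]] := extend_perm pI phiK phiK; exists t; split=> // i b; rewrite h1.
Qed.

Lemma pair_group_sign p t : pair_group p t ->
  exists eps : nat -> bool, forall i b, pf t (p (i, b)) = p (i, xorb (eps i) b).
Proof.
move=> [h _].
apply: (@choice_fun _ _ (fun i e => forall b, pf t (p (i, b)) = p (i, xorb e b))) => i.
by case: (h i) => hi; [exists false|exists true] => b; rewrite hi; case: b.
Qed.

Lemma pair_group_sqr p t x : pair_group p t -> pf t (pf t x) = x.
Proof.
move=> ht; have [eps he] := pair_group_sign ht.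
case: (classic (exists q, p q = x)) => [[[i b] <-]|hq].
  by rewrite !he; case: (eps i); case: b.
have hx : forall q, p q <> x by move=> q e; apply: hq; exists q.
by rewrite !(proj2 ht).
Qed.

(** A family that is not coinfinite cannot be carried to [p0]. Its halves of odd and of even index
    are both coinfinite, and each element is a product of one element from each half. *)
Lemma pair_group_all_preceq p p0 :
  injective p -> injective p0 -> coinfinite p0 ->
  preceq (pair_group p) (pair_group p0).
Proof.
move=> pI p0I p0C.
pose h (c : bool) (q : nat * bool) := p ((if c then 2 * fst q + 1 else 2 * fst q), snd q).
have hI c : injective (h c).
  move=> [i b] [j b'] /pI [] e <-; f_equal; move: e; case: c => /=; lia.
have hC c : coinfinite (h c).
  apply: (coinfinite_of_seq _ (e := fun i => h (negb c) (i, true))).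
    by move=> i j /hI [].
  move=> i [j b] /pI [] + _; case: c => /=; lia.
have hU : preceq (fun g => exists c, In c [true; false] /\ pair_group (h c) g) (pair_group p0).
  by apply: preceq_union => c _; apply: pair_group_preceq.
apply: preceq_trans (preceq_generated hU).
exists [] => t ht; apply: gen_base; left.
have [eps heps] := pair_group_sign ht.
have [t1 [h1 h1']] := pair_group_perm (fun i => eps (2 * i + 1)) (hI true).
have [t2 [h2 h2']] := pair_group_perm (fun i => eps (2 * i)) (hI false).
have -> : t = perm_mul t1 t2.
  apply: perm_ext => x /=.
  case: (classic (exists q, p q = x)) => [[[i b] <-]|hq].
    rewrite heps; case: (Nat.Even_or_Odd i) => [[m ->]|[m ->]].
      have -> : pf t1 (p (2 * m, b)) = p (2 * m, b).
        by apply: h1' => - [j b'] /pI [] /=; lia.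
      exact: (esym (h2 m b)).
    have -> : pf t1 (p (2 * m + 1, b)) = p (2 * m + 1, xorb (eps (2 * m + 1)) b).
      exact: (h1 m b).
    by rewrite h2' // => - [j b'] /pI [] /=; lia.
  have hx : forall q, p q <> x by move=> q e; apply: hq; exists q.
  by rewrite (proj2 ht) // h1' ?h2' // => q; exact: hx.
apply: gen_mul; apply: gen_base.
  exists true; split; [by left|split=> [i|]; last exact: h1'].
  by case e: (eps (2 * i + 1)); [right|left] => b; rewrite h1 e; case: b.
exists false; split; [by right; left|split=> [i|]; last exact: h2'].
by case e: (eps (2 * i)); [right|left] => b; rewrite h2 e; case: b.
Qed.

(** The pairs are directed, from source to target. The last clause says that no point is both, which
    also excludes loops and makes the pairs disjoint. *)
Definition matching (R : T -> T -> Prop) : Prop :=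
  (forall x y y', R x y -> R x y' -> y = y') /\
  (forall x x' y, R x y -> R x' y -> x = x') /\
  (forall x y z, R x y -> ~ R y z).

Definition match_group (R : T -> T -> Prop) (t : perm T) : Prop :=
  (forall x y, R x y -> (pf t x = x /\ pf t y = y) \/ (pf t x = y /\ pf t y = x)) /\
  (forall x, (forall y, ~ R x y /\ ~ R y x) -> pf t x = x).

Lemma match_group_infinite_preceq R p0 :
  matching R -> ~ finite_set (fun x => exists y, R x y) ->
  injective p0 -> coinfinite p0 -> preceq (match_group R) (pair_group p0).
Proof.
move=> [R1 [R2 R3]] /enum_infinite [e [eI eP]] p0I p0C.
have [d hd] : exists d : nat -> T, forall i, R (e i) (d i).
  by apply: (@choice_fun _ _ (fun i y => R (e i) y)) => i; apply: (proj2 (eP (e i))); exists i.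
pose p (q : nat * bool) := if snd q then d (fst q) else e (fst q).
have pI : injective p.
  move=> [i b] [j b'] /=; rewrite /p /=; case: b; case: b'.
  - by move=> h; f_equal; apply: eI; apply: R2 (hd i) _; rewrite h.
  - by move=> h; case: (R3 _ _ (d j) (hd i)); rewrite h.
  - by move=> h; case: (R3 _ _ (d i) (hd j)); rewrite -h.
  - by move=> /eI ->.
apply: preceq_trans (pair_group_all_preceq pI p0I p0C).
apply: preceq_sub => t [t1 t2]; split=> [i|x hx].
  by case: (t1 _ _ (hd i)) => [[h1 h2]|[h1 h2]]; [left|right] => - [].
apply: t2 => y; split=> Ry.
  have [i ei] := proj1 (eP x) (ex_intro _ y Ry); by apply: (hx (i, false)).
have [i ei] := proj1 (eP y) (ex_intro _ x Ry); apply: (hx (i, true)).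
by apply: R1 (hd i) _; rewrite ei.
Qed.

Lemma match_group_preceq R p0 :
  matching R -> injective p0 -> coinfinite p0 ->
  preceq (match_group R) (pair_group p0).
Proof.
move=> mR p0I p0C.
case: (classic (finite_set (fun x => exists y, R x y))) => [finD|infD]; last first.
  exact: match_group_infinite_preceq.
(* Finitely many sources have finitely many targets, so infinitely many points stay unmatched. *)
have infF : ~ finite_set (fun x => forall y, ~ R x y /\ ~ R y x).
  move=> finF; apply: infinite_carrier.
  have finR : finite_set (fun y => exists x, R x y).
    have [l hl] := finD.
    have [F hF] : exists F : T -> T, forall x y, R x y -> F x = y.
      apply: (@choice_fun _ _ (fun x z => forall y, R x y -> z = y)) => x.
      case: (classic (exists y, R x y)) => [[y Ry]|nR].
        by exists y => y'; apply: (proj1 mR).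
      by exists x => y Ry; case: nR; exists y.
    exists (map F l) => y [x Rxy]; rewrite -(hF x y Rxy); apply: in_map.
    by apply: hl; exists y.
  have [l hl] := finite_set_or finF (finite_set_or finD finR).
  exists l => x _; apply: hl.
  case: (classic (exists y, R x y)) => h1; first by right; left.
  case: (classic (exists y, R y x)) => h2; first by right; right.
  by left=> y; split=> Ry; [apply: h1|apply: h2]; exists y.
(* Padding with further pairs only enlarges the group, and makes the number of
   pairs infinite. *)
have [c [cI cP]] := enum_infinite infF.
have cF i y : ~ R (c i) y /\ ~ R y (c i) by apply: (proj2 (cP (c i))); exists i.
pose R' x y := R x y \/ exists i, x = c (2 * i) /\ y = c (2 * i + 1).
have mR' : matching R'.
  case: mR => R1 [R2 R3]; split; [|split].
  - move=> x y y' [h|[i [-> ->]]] [h'|[j [e ->]]].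
    + exact: R1 h h'.
    + by move: h; rewrite e => /(proj1 (cF _ _)).
    + by case: (proj1 (cF _ _) h').
    + by move/cI: e => e; f_equal; lia.
  - move=> x x' y [h|[i [-> ->]]] [h'|[j [-> e]]].
    + exact: R2 h h'.
    + by move: h; rewrite e => /(proj2 (cF _ _)).
    + by case: (proj2 (cF _ _) h').
    + by move/cI: e => e; f_equal; lia.
  - move=> x y z [h|[i [_ ->]]] [h'|[j [e _]]].
    + exact: R3 h h'.
    + by move: h; rewrite e => /(proj2 (cF _ _)).
    + by case: (proj1 (cF _ _) h').
    + by move/cI: e; lia.
apply: preceq_trans (match_group_infinite_preceq mR' _ p0I p0C); last first.
  apply: (infinite_of_seq (e := fun i => c (2 * i))); first by move=> i j /cI; lia.
  by move=> i; exists (c (2 * i + 1)); right; exists i.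
apply: preceq_sub => t [t1 t2]; split=> [x y [/t1 //|[i [-> ->]]]|x hx].
  by left; rewrite !t2.
apply: t2 => y; have [h1 h2] := hx y; split=> h; [apply: h1|apply: h2]; by left.
Qed.

(** The points of each class get distinct ranks [pos] below [n], and a permutation is sorted from
    the top rank down. Where a point of rank [k] goes to rank [j], an involution swapping the two
    points corrects this in all such classes at once. These involutions lie in finitely many match
    groups, one for each pair of distinct ranks. *)
Lemma bounded_classes_preceq (E : T -> T -> Prop) n p0 :
  (forall x y, E x y -> E y x) -> (forall x y z, E x y -> E y z -> E x z) ->
  (forall x, card_le (E x) n) -> injective p0 -> coinfinite p0 ->
  preceq (fun g => forall x, E x (pf g x)) (pair_group p0).
Proof.
move=> Esym Etr Efin p0I p0C.
have [pos [posn posI]] : exists pos : T -> nat, (forall x, E x x -> pos x < n) /\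
    (forall x y, E x y -> pos x = pos y -> x = y).
  (* The list is chosen from the class as a predicate, so that equivalent points are ranked in the
     same list. *)
  have [L hL] : exists L : (T -> Prop) -> list T, forall P, card_le P n ->
      length (L P) <= n /\ forall x, P x -> In x (L P).
    apply: (@choice_fun _ _ (fun P l => card_le P n ->
      length l <= n /\ forall x, P x -> In x l)) => P.
    case: (classic (card_le P n)) => [[l hl]|hP]; [by exists l|by exists []].
  have [pos hpos] : exists pos : T -> nat, forall x, E x x -> nth_error (L (E x)) (pos x) = Some x.
    apply: (@choice_fun _ _ (fun x k => E x x -> nth_error (L (E x)) k = Some x)) => x.
    case: (classic (E x x)) => [Exx|]; last by exists 0.
    by have [k hk] := In_nth_error _ _ (proj2 (hL _ (Efin x)) x Exx); exists k.
  exists pos; split.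
    move=> x Exx; have [h _] := hL _ (Efin x).
    have := proj1 (nth_error_Some (L (E x)) (pos x)); rewrite hpos // => h'.
    have: pos x < length (L (E x)) by apply: h'.
    lia.
  move=> x y Exy e.
  have Exx : E x x by apply: Etr Exy (Esym _ _ Exy).
  have Eyy : E y y by apply: Etr (Esym _ _ Exy) Exy.
  have EE : E x = E y.
    apply: functional_extensionality => z; apply: propositional_extensionality.
    by split; apply: Etr; [apply: Esym|].
  have := hpos x Exx; rewrite e EE hpos // => - [] //.
pose R j k x y := E x y /\ pos x = j /\ pos y = k.
pose F (jk : nat * nat) g := fst jk <> snd jk /\ match_group (R (fst jk) (snd jk)) g.
have hU : preceq (fun g => exists jk, In jk (list_prod (seq 0 n) (seq 0 n)) /\ F jk g)
                 (pair_group p0).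
  apply: preceq_union => - [j k] _.
  case: (Nat.eq_dec j k) => [<-|ne]; first by exists [] => g [] /=.
  apply: (preceq_trans (H := match_group (R j k))); first by apply: preceq_sub => g [].
  apply: match_group_preceq => //; split; [|split].
  - move=> x y y' [Exy [_ py]] [Exy' [_ py']]; apply: posI; last by rewrite py py'.
    apply: Etr Exy'; exact: Esym.
  - move=> x x' y [Exy [px _]] [Exy' [px' _]]; apply: posI; last by rewrite px px'.
    apply: Etr Exy _; exact: Esym.
  - by move=> x y z [_ [_ py]] [_ [py' _]]; apply: ne; rewrite -py -py'.
apply: preceq_trans (preceq_generated hU); apply: preceq_sub.
set X := (X in generated X).
have Erefl g x : (forall y, E y (pf g y)) -> E x x.
  by move=> h; apply: Etr (h x) _; apply: Esym.
(* Outer induction: all points of rank at least [k] are already fixed. *)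
suff claim k : k <= n -> forall g, (forall x, E x (pf g x)) ->
    (forall x, k <= pos x -> pf g x = x) -> generated X g.
  move=> g hg; apply: (claim n) => // x hx.
  have := posn x (Erefl g x hg); lia.
elim: k => [|k IHk] lekn g hg fixg.
  have -> : g = perm_id T by apply: perm_ext => x; apply: fixg; lia.
  exact: gen_id.
(* Inner induction: the points of rank [k] that still move go to ranks below [j]. *)
suff claim j : j <= n -> forall g, (forall x, E x (pf g x)) ->
    (forall x, k < pos x -> pf g x = x) ->
    (forall x, pos x = k -> pf g x = x \/ pos (pf g x) < j) -> generated X g.
  apply: (claim n) => // x _; right; apply: posn; exact: Erefl hg.
elim: j {g hg fixg} => [|j IHj] lejn g hg fixg hk.
  apply: IHk => //; first lia; move=> x hx; case: (Nat.eq_dec (pos x) k) => e; last by apply: fixg; lia.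
  by case: (hk x e) => // ?; lia.
(* For [j >= k] nothing needs swapping: an image of rank [k] in the same class is the point itself,
   and an image of higher rank is fixed by [g], hence equals the point. *)
case: (le_lt_dec k j) => hjk.
  apply: IHj => //; first lia; move=> x px; case: (hk x px) => [->|lt]; first by left.
  case: (Nat.eq_dec (pos (pf g x)) j) => e; last by right; lia.
  left; case: (Nat.eq_dec j k) => ejk; first by apply/esym/posI; rewrite ?px ?e.
  by apply: (@pf_inj _ g); apply: fixg; lia.
(* [Y] lists the points of rank [k] sent to rank [j], each together with its image; [phi] exchanges
   the two. *)
pose Y := ({x | pos x = k /\ pos (pf g x) = j} * bool)%type.
pose r (q : Y) := if snd q then pf g (proj1_sig (fst q)) else proj1_sig (fst q).
pose phi (q : Y) := (fst q, negb (snd q)).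
have phiK : cancel phi phi by move=> [x []].
have rI : injective r.
  move=> [[x [hx hx']] b] [[y [hy hy']] b']; rewrite /r /=.
  case: b; case: b' => e.
  - have exy : x = y by apply: pf_inj e.
    by subst y; f_equal; f_equal; apply: proof_irrelevance.
  - by exfalso; move: hy; rewrite -e hx'; lia.
  - by exfalso; move: hx; rewrite e hy'; lia.
  - by subst y; f_equal; f_equal; apply: proof_irrelevance.
have [t [ht ht']] := extend_perm rI phiK phiK.
have tk x (px : pos x = k) (pgx : pos (pf g x) = j) : pf t x = pf g x /\ pf t (pf g x) = x.
  by split; [exact: (ht (exist _ x (conj px pgx), false))|exact: (ht (exist _ x (conj px pgx), true))].
have to y : ~ (pos y = k /\ pos (pf g y) = j) ->
    (forall x, pos x = k -> pos (pf g x) = j -> pf g x <> y) -> pf t y = y.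
  move=> h1 h2; apply: ht' => - [[x [px pgx]] b]; rewrite /r /=.
  case: b; first exact: h2.
  by move=> e; apply: h1; rewrite -e.
have Xt : X t.
  exists (j, k); split; first by apply: in_prod; apply/in_seq; lia.
  split=> /=; first lia.
  split=> [y x [Eyx [py px]]|y hy].
    case: (classic (pf g x = y)) => e.
      have pgx : pos (pf g x) = j by rewrite e.
      by right; have := tk x px pgx; rewrite e => - [-> ->].
    have ng : pos (pf g x) <> j.
      move=> pg; apply: e; apply: posI; last by rewrite pg.
      apply: Etr (Esym _ _ Eyx); apply: Esym; exact: hg.
    left; split; apply: to; try by [move=> []; lia].
      move=> x' px' pgx' e'; apply: e; rewrite -e'; f_equal; apply: posI; last by lia.
      apply: Etr (Esym _ _ Eyx) _; rewrite -e'; apply: Esym; exact: hg.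
    by move=> x' px' pgx' e'; move: pgx'; rewrite e'; lia.
  apply: to.
    by move=> [py pgy]; apply: (proj2 (hy (pf g y))); split; [apply: Esym; exact: hg|].
  by move=> x px pgx e; apply: (proj1 (hy x)); split; [rewrite -e; apply: Esym; exact: hg|rewrite -e].
(* In [perm_mul g t] the points of [Y] of rank [k] have become fixed, and no image of rank [j]
   remains for the moved points of rank [k]. *)
have -> : g = perm_mul (perm_mul g t) (perm_inv t).
  by apply: perm_ext => x /=; rewrite pinvK.
apply: gen_mul; last by apply: gen_inv; apply: gen_base.
apply: IHj => /=; first lia.
- move=> x.
  case: (classic (exists y, pos y = k /\ pos (pf g y) = j /\ (y = pf g x \/ pf g y = pf g x))).
    move=> [y [py [pgy [e|e]]]].
      by rewrite -e (proj1 (tk y py pgy)); apply: Etr (hg x) _; rewrite -e; exact: hg.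
    rewrite -e (proj2 (tk y py pgy)).
    have <- : y = x by apply: pf_inj e.
    exact: Erefl hg.
  move=> h; suff -> : pf t (pf g x) = pf g x by exact: hg.
  apply: to.
    by move=> [h1 h2]; apply: h; exists (pf g x); split=> //; split=> //; left.
  by move=> y h1 h2 e; apply: h; exists y; split=> //; split=> //; right.
- move=> x px; rewrite fixg //; apply: to; first by move=> []; lia.
  by move=> y py pgy e; move: px; rewrite -e; lia.
- move=> x px; case: (hk x px) => [e|lt].
    left; rewrite e; apply: to; first by rewrite e; lia.
    by move=> y py pgy e'; move: px; rewrite -e' pgy; lia.
  case: (Nat.eq_dec (pos (pf g x)) j) => e; first by left; apply: (proj2 (tk x px e)).
  suff -> : pf t (pf g x) = pf g x by right; lia.
  apply: to; first by lia.
  by move=> y py pgy e'; apply: e; rewrite -e'.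
Qed.

(** * Closed groups covered by words *)

(** The last letter acts last, so images can be counted letter by letter. *)
Inductive word (X : perm T -> Prop) : nat -> perm T -> Prop :=
| word_nil : word X 0 (perm_id T)
| word_snoc m g f : word X m g -> X f \/ X (perm_inv f) -> word X (S m) (perm_mul g f).

Lemma word_mul X m k f g : word X m f -> word X k g -> word X (k + m) (perm_mul f g).
Proof.
move=> hf; elim=> [|k' g1 g2 _ IH hg] /=.
  by have -> : perm_mul f (perm_id T) = f by apply: perm_ext.
have -> : perm_mul f (perm_mul g1 g2) = perm_mul (perm_mul f g1) g2 by apply: perm_ext.
exact: word_snoc.
Qed.

Lemma word_inv X m f : word X m f -> word X m (perm_inv f).
Proof.
elim=> [|k g1 g2 _ IH hg]; first exact: word_nil.
have -> : perm_inv (perm_mul g1 g2) =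
    perm_mul (perm_mul (perm_id T) (perm_inv g2)) (perm_inv g1) by apply: perm_ext.
rewrite -Nat.add_1_r; apply: word_mul IH; apply: word_snoc; first exact: word_nil.
have -> : perm_inv (perm_inv g2) = g2 by apply: perm_ext.
by case: hg; [right|left].
Qed.

Lemma generated_word X g : generated X g -> exists m, word X m g.
Proof.
elim=> [f hf||f1 f2 _ [m1 h1] _ [m2 h2]|f1 _ [m1 h1]].
- exists 1; have -> : f = perm_mul (perm_id T) f by apply: perm_ext.
  by apply: word_snoc; [exact: word_nil|left].
- by exists 0; exact: word_nil.
- by exists (m2 + m1); apply: word_mul.
- by exists m1; apply: word_inv.
Qed.

Lemma word_image_bound X c :
  (forall x, card_le (fun y => exists f, (X f \/ X (perm_inv f)) /\ pf f x = y) c) ->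
  forall m x, card_le (fun y => exists g, word X m g /\ pf g x = y) (c ^ m).
Proof.
move=> /(@choice_fun _ _ (fun x l => length l <= c /\ forall y, _ -> In y l)) [L hL].
elim=> [|m IH] x.
  exists [x]; split=> //= y [g [hg <-]]; left.
  by inversion hg.
have [l [ll hl]] := IH x.
exists (flat_map L l); split.
  have : length (flat_map L l) <= c * length l.
    elim: l {ll hl} => [|a l IHl] /=; first lia.
    rewrite length_app; have [h _] := hL a; nia.
  move=> /=; nia.
move=> y [g [hg <-]]; inversion hg as [|m' g1 f h1 hf]; subst.
apply/in_flat_map; exists (pf g1 x); split; first by apply: hl; exists g1.
by apply: (proj2 (hL _)); exists f.
Qed.

(** The pair group contributes the point and its partner, the list [U] its elements and their
    inverses. *)
Lemma pair_group_image_bound p (U : list (perm T)) x :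
  injective p ->
  let X := fun h => pair_group p h \/ In h U in
  card_le (fun y => exists f, (X f \/ X (perm_inv f)) /\ pf f x = y) (2 + 2 * length U).
Proof.
move=> pI X.
have [z hz] : exists z, forall f, pair_group p f -> pf f x = x \/ pf f x = z.
  case: (classic (exists q, p q = x)) => [[[i b] <-]|hq].
    by exists (p (i, negb b)) => f [/(_ i) [h|h] _]; [left|right].
  exists x => f [_ h]; left; apply: h => q e; by apply: hq; exists q.
exists ([x; z] ++ map (fun u => pf u x) U ++ map (fun u => pinv u x) U); split.
  rewrite !length_app !length_map /=; lia.
move=> y [f [hf <-]].
have case1 : (pf f x = x \/ pf f x = z) \/ (In f U \/ In (perm_inv f) U).
  case: hf => [[/hz h|h]|[h|h]]; [by left|by right; left| |by right; right].
  have e : pf f x = pinv f x.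
    by have := pair_group_sqr x h; rewrite /= => {1}<-; rewrite pfK.
  by left; rewrite e; apply: (hz (perm_inv f)).
case: case1 => [[->|->]|[h|h]]; [by left|by right; left| |];
  apply/in_or_app; right; apply/in_or_app; [left|right].
  by apply/in_map_iff; exists f.
by apply/in_map_iff; exists (perm_inv f).
Qed.

(** A pointwise limit of permutations is injective but need not be onto; the hypothesis on the
    images of the [D n] supplies surjectivity. *)
Lemma limit_perm G (g : nat -> perm T) (D : nat -> list T) :
  closed_sub G -> (forall n, G (g n)) ->
  (forall n x, In x (D n) -> In x (D (S n))) ->
  (forall n x, In x (D n) -> pf (g (S n)) x = pf (g n) x) ->
  (forall x, exists n, In x (D n)) ->
  (forall y, exists n x, In x (D n) /\ pf (g n) x = y) ->
  exists f, G f /\ forall n x, In x (D n) -> pf f x = pf (g n) x.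
Proof.
move=> clG Gg Dinc gag /(@choice_fun _ _ (fun x n => In x (D n))) [k hk] gsur.
have stab n m x : n <= m -> In x (D n) -> In x (D m) /\ pf (g m) x = pf (g n) x.
  move=> le hx; elim: le => [//|m' _ [IH1 IH2]].
  by split; [exact: Dinc|rewrite gag].
pose F x := pf (g (k x)) x.
have FE n x : In x (D n) -> F x = pf (g n) x.
  move=> hx; rewrite /F; case: (le_ge_dec (k x) n) => le.
    by rewrite (proj2 (stab _ _ _ le (hk x))).
  by rewrite (proj2 (stab _ _ _ le hx)).
have [||f hf] := @perm_of_bij _ F.
- move=> x y; set n := max (k x) (k y).
  have [|hx _] := stab _ n x _ (hk x); first by lia.
  have [|hy _] := stab _ n y _ (hk y); first by lia.
  by rewrite (FE n) // (FE n) // => e; exact: pf_inj e.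
- by move=> y; have [n [x [hx <-]]] := gsur y; exists x; apply: FE.
exists f; split; last by move=> n x hx; rewrite hf; apply: FE.
apply: clG => l.
have [n hn] : exists n, forall x, In x l -> In x (D n).
  elim: l => [|a l [n hn]]; first by exists 0.
  exists (max (k a) n) => x [<-|/hn hx].
    by apply: (proj1 (stab _ _ _ _ (hk a))); lia.
  by apply: (proj1 (stab _ _ _ _ hx)); lia.
by exists (g n); split=> // x /hn hx; rewrite hf (FE n).
Qed.

Lemma card_le_mono (P Q : T -> Prop) m n :
  (forall x, P x -> Q x) -> m <= n -> card_le Q m -> card_le P n.
Proof. by move=> h le [l [ll hl]]; exists l; split; [lia|move=> x /h /hl]. Qed.

(* A Baire category argument: otherwise one builds, one finite approximation at
   a time, an element of [G] avoiding every [W m]. *)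
Lemma closed_cover_bounded_orbits G (W : nat -> perm T -> Prop) (N : nat -> nat) :
  is_subgroup G -> closed_sub G ->
  (forall m x, card_le (fun y => exists g, W m g /\ pf g x = y) (N m)) ->
  (forall g, G g -> exists m, W m g) ->
  exists (Gamma : list T) (n : nat), 0 < n /\
    forall x, card_le (orbit (ptwise_stab G Gamma) x) n.
Proof.
move=> [G1 [GM GV]] clG bW cov; apply: NNPP => nb.
have big D n : exists x, ~ card_le (orbit (ptwise_stab G D) x) n.
  apply: NNPP => h; apply: nb; exists D, (S n); split; first lia.
  move=> x; have : card_le (orbit (ptwise_stab G D) x) n.
    by apply: NNPP => h'; apply: h; exists x.
  by apply: card_le_mono => //; lia.
pose I (s : perm T * list T) := G (fst s).
(* A step keeps the values already fixed, separates the approximation from all of [W m], and puts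
   [nu m] into both domain and range. *)
pose R m (s s' : perm T * list T) :=
  (forall x, In x (snd s) -> In x (snd s') /\ pf (fst s') x = pf (fst s) x) /\
  (forall w, W m w -> exists y, In y (snd s') /\ pf w y <> pf (fst s') y) /\
  In (nu m) (snd s') /\ (exists z, In z (snd s') /\ pf (fst s') z = nu m).
have [||sq [_ hsq]] := @dependent_choice _ I R (perm_id T, []).
- exact: G1.
- move=> m [g D] Gg; rewrite /I /= in Gg.
  (* Since [W m] gives [y] at most [N m] images, some [h] in the stabilizer of the earlier values
     moves [x] to a point that is none of them. Then [perm_mul g h] sends [y] to that point. *)
  have [x hx] := big (map (pf g) D) (N m).
  pose y := pinv g x.
  have [h [[Gh fixh] hy]] : exists h, ptwise_stab G (map (pf g) D) h /\
      forall w, W m w -> pf w y <> pf h x.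
    apply: NNPP => none; apply: hx; apply: card_le_mono (bW m y) => // z [h [hh <-]].
    apply: NNPP => hw; apply: none; exists h; split=> // w Ww e; apply: hw.
    by exists w.
  pose g' := perm_mul g h.
  exists (g', y :: nu m :: pinv g' (nu m) :: D); split; first exact: GM.
  split; [|split; [|split]].
  + move=> a ha; split; first by do 3 right.
    by apply: fixh; apply: in_map.
  + move=> w Ww; exists y; split; first by left.
    rewrite /= /y pfK; exact: hy.
  + by right; left.
  + exists (pinv g' (nu m)); split; [by right; right; left|exact: pfK].
have [|||||f [Gf hf]] := @limit_perm G (fun n => fst (sq n)) (fun n => snd (sq n)) clG.
- by move=> n; apply: (proj1 (hsq n)).
- by move=> n x hx; apply: (proj1 (proj1 (proj2 (hsq n)) x hx)).
- by move=> n x hx; apply: (proj2 (proj1 (proj2 (hsq n)) x hx)).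
- move=> x; exists (S (idx x)).
  have [_ [_ [_ [h _]]]] := hsq (idx x); by rewrite idxK in h.
- move=> x; exists (S (idx x)).
  have [_ [_ [_ [_ [z hz]]]]] := hsq (idx x); by exists z; rewrite idxK in hz.
have [m Wm] := cov f Gf.
have [_ [_ [hd _]]] := hsq m.
by have [y [hy ne]] := hd f Wm; apply: ne; exact: hf.
Qed.

(** * Countable sets of permutations and coset representatives *)

Definition countable_perms (X : perm T -> Prop) : Prop :=
  exists s : nat -> perm T, forall g, X g -> exists n, s n = g.

Lemma countable_word X : countable_perms X -> forall m, countable_perms (word X m).
Proof.
move=> [s hs].
pose s' n := let (b, k) := of_nat n in if b =? 0 then s k else perm_inv (s k).
have hs' f : X f \/ X (perm_inv f) -> exists n, s' n = f.
  move=> [/hs [k hk]|/hs [k hk]]; [exists (to_nat (0, k))|exists (to_nat (1, k))];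
    rewrite /s' cancel_of_to /= hk //.
  exact: perm_ext.
elim=> [|m [r hr]].
  by exists (fun _ => perm_id T) => g hg; exists 0; inversion hg.
exists (fun n => let (a, b) := of_nat n in perm_mul (r a) (s' b)) => g hg.
inversion hg as [|m' g1 f h1 hf]; subst.
have [a ha] := hr _ h1; have [b hb] := hs' _ hf.
by exists (to_nat (a, b)); rewrite cancel_of_to ha hb.
Qed.

Lemma countable_generated X : countable_perms X -> countable_perms (generated X).
Proof.
move=> /countable_word /(@choice_fun _ _ (fun m s => forall g, word X m g -> exists n, s n = g)) [s hs].
exists (fun n => let (a, b) := of_nat n in s a b) => g /generated_word [m hm].
by have [n hn] := hs m g hm; exists (to_nat (m, n)); rewrite cancel_of_to.
Qed.

(** Diagonal argument: [eps i] is chosen so that the result differs from [s i] at [p (i, false)]. *)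
Lemma pair_group_uncountable p : injective p -> ~ countable_perms (pair_group p).
Proof.
move=> pI [s hs].
have [eps he] : exists eps : nat -> bool, forall i, pf (s i) (p (i, false)) <> p (i, eps i).
  apply: (@choice_fun _ _ (fun i e => pf (s i) (p (i, false)) <> p (i, e))) => i.
  case: (classic (pf (s i) (p (i, false)) = p (i, false))) => h; last by exists false.
  by exists true; rewrite h => /pI.
have [t [h1 h2]] := pair_group_perm eps pI.
have [|n hn] := hs t.
  by split=> // i; case e: (eps i); [right|left] => b; rewrite h1 e; case: b.
by apply: (he n); rewrite hn h1; case: (eps n).
Qed.

(** A coset of the stabilizer is determined by the images of the points of [D], and these have
    countably many codes. A code that no element of [G] attains gets the identity. *)
Lemma coset_representatives G (D : list T) : is_subgroup G ->
  exists s : nat -> perm T, (forall n, G (s n)) /\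
    forall g, G g -> exists n, ptwise_stab G D (perm_mul g (perm_inv (s n))).
Proof.
move=> [G1 [GM GV]].
have [code hcode] : exists code : perm T -> nat, forall g h, code g = code h ->
    forall x, In x D -> pf g x = pf h x.
  elim: D => [|a D [code hcode]]; first by exists (fun _ => 0).
  exists (fun g => to_nat (idx (pf g a), code g)) => g h /(can_inj cancel_of_to) [e1 e2] x [<-|].
    by rewrite -(idxK (pf g a)) e1 idxK.
  exact: hcode.
have [s hs] : exists s : nat -> perm T, forall n, G (s n) /\
    forall g, G g -> code g = n -> code (s n) = n.
  apply: (@choice_fun _ _ (fun n f => G f /\ forall g, G g -> code g = n -> code f = n)) => n.
  case: (classic (exists g, G g /\ code g = n)) => [[g [Gg cg]]|h].
    by exists g.
  by exists (perm_id T); split=> // g Gg cg; case: h; exists g.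
exists s; split=> [n|g Gg]; first exact: (proj1 (hs n)).
have [Gs /(_ g Gg erefl) cs] := hs (code g).
exists (code g); split; first by apply: GM => //; exact: GV.
by move=> x hx /=; rewrite -(hcode _ _ cs x hx) pinvK.
Qed.

Lemma countable_trivial_stab G (D : list T) : is_subgroup G ->
  (forall g, ptwise_stab G D g -> g = perm_id T) -> countable_perms G.
Proof.
move=> sG triv; have [s [Gs hs]] := coset_representatives D sG.
exists s => g Gg; have [n /triv hn] := hs g Gg; exists n; apply: perm_ext => x.
have /= e : pf (perm_mul g (perm_inv (s n))) x = x by rewrite hn.
by rewrite -{1}e pfK.
Qed.

Lemma pair_group_not_preceq_trivial_stab G p (D : list T) : is_subgroup G -> injective p ->
  (forall g, ptwise_stab G D g -> g = perm_id T) -> ~ preceq (pair_group p) G.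
Proof.
move=> sG pI /(countable_trivial_stab sG) [s hs] [U hU].
apply: (pair_group_uncountable pI).
have [|r hr] := @countable_generated (fun h => G h \/ In h U); last first.
  by exists r => g /hU /hr.
exists (fun n => let (a, b) := of_nat n in if a =? 0 then s b else nth b U (perm_id T)).
move=> g [/hs [n hn]|hg]; first by exists (to_nat (0, n)); rewrite cancel_of_to.
have [n [_ hn]] := In_nth U g (perm_id T) hg.
by exists (to_nat (1, n)); rewrite cancel_of_to.
Qed.

(** * Recovering a pair group *)

(** Only the images of the points [p (i, false)] are prescribed; the element [f] may do anything
    elsewhere. *)
Definition independent_moves G : Prop :=
  exists p : nat * bool -> T, injective p /\
    forall eps : nat -> bool, exists f, G f /\ forall i, pf f (p (i, false)) = p (i, eps i).

(* With [u] a product of transpositions, the commutators [u u^f] are products of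
   double transpositions, over an arbitrary set of indices. Chaining these along
   infinite rows, the product with a shifted copy telescopes to one transposition
   per row. *)
Lemma independent_moves_preceq G p0 :
  independent_moves G -> injective p0 -> coinfinite p0 -> preceq (pair_group p0) G.
Proof.
move=> [p [pI hp]] p0I p0C.
pose X := (nat * nat * bool * bool)%type.
(* Row [j], position [m] and copy [k] are coded by even indices; the odd ones stay free to make [r]
   coinfinite. *)
pose code j m (k : bool) := 2 * to_nat (j, to_nat (m, Nat.b2n k)).
pose r (q : X) := let '(j, m, b, k) := q in p (code j m k, b).
have codeI j m k j' m' k' : code j m k = code j' m' k' -> (j, m, k) = (j', m', k').
  move=> e; have : to_nat (j, to_nat (m, Nat.b2n k)) = to_nat (j', to_nat (m', Nat.b2n k')).
    by move: e; rewrite /code; lia.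
  move=> /(can_inj cancel_of_to) /pair_equal_spec [-> ].
  move=> /(can_inj cancel_of_to) /pair_equal_spec [-> ].
  by case: k {e}; case: k'.
have rI : injective r.
  by move=> [[[j m] b] k] [[[j' m'] b'] k'] /pI [/codeI [-> -> ->] ->].
have rC : coinfinite r.
  apply: (coinfinite_of_seq _ (e := fun i => p (2 * i + 1, true))).
    by move=> i j /pI []; lia.
  by move=> i [[[j m] b] k] /pI []; rewrite /code; lia.
(* A row runs through [(m, false)], [(m, true)], [(S m, false)] and so on; the shift misses exactly
   its start [(0, false)]. *)
pose sh (q : X) : X := let '(j, m, b, k) := q in
  if b then (j, S m, false, k) else (j, m, true, k).
have shI : injective sh.
  by move=> [[[j m] b] k] [[[j' m'] b'] k'] /=; case: b; case: b' => - [] *; subst.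
pose flip (q : X) : X := let '(j, m, b, k) := q in
  if b then (j, m, b, k) else (j, m, b, negb k).
have flipK : cancel flip flip.
  by move=> [[[j m] b] k] /=; case: b => //=; case: k.
have [u [hu hu']] := extend_perm rI flipK flipK.
have [s hs] : exists s, forall q, pf s (r q) = r (sh q).
  apply: perm_extending => //; first by move=> x y /rI /shI.
  move=> [l hl]; apply: rC; exists l => x hx; apply: hl => q; exact: hx.
pose p1 (q : nat * bool) := r (fst q, 0, false, snd q).
have p1I : injective p1 by move=> [j k] [j' k'] /rI [-> ->].
have p1C : coinfinite p1.
  move=> [l hl]; apply: rC; exists l => x hx; apply: hl => q; exact: hx.
apply: preceq_trans (pair_group_preceq p0I p0C p1I p1C) _.
exists [u; s] => t ht.
have [dl hdl] := pair_group_sign ht.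
(* Halving and decoding an index recovers its row, so [f] makes the same choice [dl j] along all of
   row [j]. *)
have [f [Gf hf0]] := hp (fun i => dl (fst (of_nat (i / 2)))).
have hf j m k : pf f (r (j, m, false, k)) = r (j, m, dl j, k).
  rewrite /r hf0 /code Nat.mul_comm Nat.div_mul // cancel_of_to //.
clearbody r; pose v := conj_perm f u.
have hv j m k : pf v (r (j, m, dl j, k)) = r (j, m, dl j, negb k).
  by rewrite -(hf j m k) /v pf_conj hu -[flip _]/(j, m, false, negb k) hf.
have hv' y : (forall j m k, r (j, m, dl j, k) <> y) -> pf v y = y.
  move=> hy; rewrite /v /=.
  suff -> : pf u (pinv f y) = pinv f y by rewrite pfK.
  case: (classic (exists q, r q = pinv f y)) => [[[[[j m] b] k] e]|hq].
    rewrite -e hu; case: b e => // e.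
    by case: (hy j m k); rewrite -hf e pfK.
  by apply: hu' => q e; apply: hq; exists q.
have gens g : In g [u; s] -> generated (fun h => G h \/ In h [u; s]) g.
  by move=> hg; apply: gen_base; right.
have gu := gens u (or_introl erefl); have gs := gens s (or_intror (or_introl erefl)).
have gv : generated (fun h => G h \/ In h [u; s]) v.
  by apply: generated_conj => //; apply: gen_base; left.
(* If [dl j] is [false], the two factors cancel on row [j]. Otherwise [u] swaps the copies at the
   [false] points and [v] at the [true] points, so [D] swaps them along the whole row. *)
clearbody v; pose D := perm_mul u v.
have hD j m b k : pf D (r (j, m, b, k)) = r (j, m, b, xorb (dl j) k).
  have vfix k' : b <> dl j -> pf v (r (j, m, b, k')) = r (j, m, b, k').
    by move=> ne; apply: hv' => j' m' k'' /rI [e1 _ e2 _]; apply: ne; rewrite -e2 e1.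
  have vflip k' : b = dl j -> pf v (r (j, m, b, k')) = r (j, m, b, negb k').
    by move=> ->; apply: hv.
  rewrite -[LHS]/(pf v (pf u _)) hu /=.
  case: b vfix vflip => vfix vflip; case: (dl j) vfix vflip => vfix vflip.
  - by rewrite vflip.
  - by rewrite vfix.
  - by rewrite vfix.
  - by rewrite vflip //; case: k.
have hD' x : (forall q, r q <> x) -> pf D x = x.
  by move=> hx; rewrite -[LHS]/(pf v (pf u _)) hu' // hv'.
have gD : generated (fun h => G h \/ In h [u; s]) D by apply: gen_mul.
(* Conjugation by the shift gives the same swaps without those at the row starts, so [perm_mul D D2]
   acts only there, as [t] does. *)
clearbody D; pose D2 := conj_perm s D.
have hD2 q : pf D2 (r (sh q)) = pf s (pf D (r q)) by rewrite -hs pf_conj.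
have hD2' x : (forall q, r (sh q) <> x) -> pf D2 x = x.
  move=> hx; rewrite /D2 /=; suff -> : pf D (pinv s x) = pinv s x by rewrite pfK.
  by apply: hD' => q e; apply: (hx q); rewrite -hs e pfK.
have gD2 : generated (fun h => G h \/ In h [u; s]) D2 by apply: generated_conj.
clearbody D2.
suff -> : t = perm_mul D D2 by apply: gen_mul.
apply: perm_ext => x; rewrite -[RHS]/(pf D2 (pf D x)).
case: (classic (exists q, r q = x)) => [[q <-]|hq]; last first.
  have hx : forall q, r q <> x by move=> q e; apply: hq; exists q.
  by rewrite hD' // hD2' //; apply: (proj2 ht) => q'; exact: hx.
case: (classic (exists q', q = sh q')) => [[q' ->]|hq].
  have -> : pf t (r (sh q')) = r (sh q').
    apply: (proj2 ht) => - [j k] /rI /=.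
    by case: q' => [[[j' m'] b'] k'] /=; case: b'.
  move: q' => [[[j m] b] k].
  have e c : sh (j, m, b, c) = (j, (if b then S m else m), negb b, c) by case: b.
  by rewrite e hD -!e hD2 hD hs; case: (dl j); case: k.
have [j [k ->]] : exists j k, q = (j, 0, false, k).
  case: q hq => [[[j m] b] k] hq; case: b hq => hq; first by case: hq; exists (j, m, false, k).
  by case: m hq => [|m] hq; [exists j, k|case: hq; exists (j, m, true, k)].
rewrite hD hD2'; last exact: (hdl j k).
by move=> [[[j' m'] b'] k'] /rI /=; case: b'.
Qed.

(** Stated for any type because it is applied to the members of a partition, which are not indexed
    by [nu]. *)
Lemma infinite_seq (S : Type) (P : S -> Prop) : ~ finite_set P ->
  exists e : nat -> S, injective e /\ forall n, P (e n).
Proof.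
move=> infP.
have [||f [_ hf]] := @dependent_choice (list S) (fun _ => True)
    (fun _ l l' => exists a, l' = a :: l /\ P a /\ ~ In a l) [].
- by [].
- by move=> _ l _; have [a ha] := infinite_avoid l infP; exists (a :: l); split=> //; exists a.
have [e he] : exists e : nat -> S, forall n, f (Datatypes.S n) = e n :: f n /\ P (e n) /\ ~ In (e n) (f n).
  apply: (@choice_fun _ _ (fun n a => f (Datatypes.S n) = a :: f n /\ P a /\ ~ In a (f n))) => n.
  exact: (proj2 (hf n)).
have hin i j : i < j -> In (e i) (f j).
  elim: j => [|j IH] lt; first lia.
  rewrite (proj1 (he j)); case: (Nat.eq_dec i j) => [->|ne]; first by left.
  right; apply: IH; lia.
exists e; split=> [i j eij|n]; last by have [_ []] := he n.
case: (lt_eq_lt_dec i j) => [[/hin|//]|/hin].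
  by rewrite eij => h; have [_ [_ []]] := he j.
by rewrite -eij => h; have [_ [_ []]] := he i.
Qed.

Lemma independent_moves_partition (C : (T -> Prop) -> Prop) :
  is_partition C -> ~ finite_set (fun Sg => C Sg /\ card_gt1 Sg) ->
  independent_moves (stab_partition C).
Proof.
move=> [_ [Cdis _]] /infinite_seq [B [BI hB]].
have [d hd] : exists d : nat -> T * T, forall n,
    fst (d n) <> snd (d n) /\ B n (fst (d n)) /\ B n (snd (d n)).
  apply: (@choice_fun _ _ (fun n d => fst d <> snd d /\ B n (fst d) /\ B n (snd d))) => n.
  by have [_ [x [y h]]] := hB n; exists (x, y).
pose p (q : nat * bool) := if snd q then snd (d (fst q)) else fst (d (fst q)).
have Bp i b : B i (p (i, b)) by have [_ []] := hd i; case: b.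
have pI : injective p.
  move=> [i b] [j b'] e.
  have eij : i = j.
    apply: BI; apply: Cdis (proj1 (hB i)) (proj1 (hB j)) _.
    by exists (p (i, b)); split=> //; rewrite e.
  subst j; have [ne _] := hd i; case: b b' e => - [] //; rewrite /p /= => e; case: ne => //.
exists p; split=> // eps.
have [t [h1 h2]] := pair_group_perm eps pI.
have tp : pair_group p t.
  by split=> // i; case e: (eps i); [right|left] => b; rewrite h1 e; case: b.
exists t; split; last by move=> i; rewrite h1; case: (eps i).
have tS Sg x : C Sg -> Sg x -> Sg (pf t x).
  move=> CS Sx; case: (classic (exists q, p q = x)) => [[[i b] e]|hq].
    have -> : Sg = B i by apply: Cdis CS (proj1 (hB i)) _; exists x; split=> //; rewrite -e.
    by rewrite -e h1.
  by rewrite h2 // => q e; apply: hq; exists q.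
move=> Sg CS; split=> [x|y Sy]; first exact: tS.
by exists (pf t y); split; [exact: tS|exact: pair_group_sqr tp].
Qed.

(** The pairs are taken in orbits lying outside growing finite invariant sets [D n]. The choices are
    then realized one after another by elements fixing [D n], and closedness provides the limit. *)
Lemma independent_moves_closed G : is_subgroup G -> closed_sub G ->
  (exists (Gamma : list T) (n : nat), forall x, card_le (orbit (ptwise_stab G Gamma) x) n) ->
  ~ (exists Gamma : list T, forall g, ptwise_stab G Gamma g -> g = perm_id T) ->
  independent_moves G.
Proof.
move=> [G1 [GM GV]] clG bnd ntriv.
(* As the bound [N] on the orbits is minimal, each stabilizer in [H] is transitive
   on some orbit of [H] of size [N]. *)
have [N [[Gam hN] minN]] : exists N,
    (exists D, forall x, card_le (orbit (ptwise_stab G D) x) N) /\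
    forall m, m < N -> ~ exists D, forall x, card_le (orbit (ptwise_stab G D) x) m.
  have [D [n hn]] := bnd; elim/lt_wf_ind: n D hn => n IH D hn.
  case: (classic (exists m, m < n /\ exists D, forall x, card_le (orbit (ptwise_stab G D) x) m)).
    by move=> [m [lt [D' hD']]]; exact: IH m lt D' hD'.
  by move=> h; exists n; split; [exists D|move=> m lt h'; apply: h; exists m].
set H := ptwise_stab G Gam in hN.
have H1 : H (perm_id T) by [].
have HM f g : H f -> H g -> H (perm_mul f g).
  move=> [Gf hf] [Gg hg]; split; first exact: GM.
  by move=> x hx /=; rewrite hf // hg.
have HV f : H f -> H (perm_inv f).
  move=> [Gf hf]; split; first exact: GV.
  by move=> x hx /=; rewrite -{1}(hf x hx) pinvK.
have orefl x : orbit H x x by exists (perm_id T).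
(* Orbits with at most one point would make [H] trivial. *)
have N2 : 2 <= N.
  case: (le_lt_dec 2 N) => // lt; exfalso; apply: ntriv; exists Gam => g hg.
  apply: perm_ext => x /=; have [l [ll hl]] := hN x.
  have h1 := hl _ (orefl x).
  have h2 : In (pf g x) l by apply: hl; exists g.
  case: l ll h1 h2 {hl} => [|a [|b l]] /= ll; [by []| |lia].
  by move=> [<-|//] [<-|//].
have step D : exists x y, y <> x /\ orbit H x y /\
    forall z, orbit H x z -> exists h, H h /\ (forall a, In a D -> pf h a = a) /\ pf h x = z.
  have [x hx] : exists x, ~ card_le (orbit (ptwise_stab G (Gam ++ D)) x) (N - 1).
    apply: NNPP => h; apply: (minN (N - 1)); first lia.
    by exists (Gam ++ D) => x; apply: NNPP => h'; apply: h; exists x.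
  have sub z : orbit (ptwise_stab G (Gam ++ D)) x z -> orbit H x z.
    move=> [h [[Gh fh] e]]; exists h; split=> //; split=> // a ha.
    by apply: fh; apply/in_or_app; left.
  (* If the smaller group missed a point [z] of the orbit, deleting [z] from the list would bound
     its orbit by [N - 1]. *)
  have tr z : orbit H x z -> orbit (ptwise_stab G (Gam ++ D)) x z.
    move=> oz; apply: NNPP => nz; apply: hx.
    have [l [ll hl]] := hN x.
    have [l1 [l2 el]] := in_split _ _ (hl _ oz).
    exists (l1 ++ l2); split.
      by move: ll; rewrite el !length_app /=; lia.
    move=> w ow; have := hl w (sub _ ow); rewrite el => hw.
    case: (in_app_or _ _ _ hw) => [hw1|[e|hw2]].
    - by apply/in_or_app; left.
    - by case: nz; rewrite e.
    - by apply/in_or_app; right.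
  have [y [ney oy]] : exists y, y <> x /\ orbit H x y.
    apply: NNPP => none; apply: hx; exists [x]; split; first by move=> /=; lia.
    move=> y /sub oy; left; apply: NNPP => ne; apply: none; exists y; split=> // e.
    by apply: ne.
  exists x, y; split=> //; split=> // z /tr [h [[Gh fh] e]]; exists h; split.
    by split=> // a ha; apply: fh; apply/in_or_app; left.
  by split=> // a ha; apply: fh; apply/in_or_app; right.
have inv_orbit x z h : H h -> orbit H x z -> orbit H x (pf h z).
  by move=> Hh [k [Hk <-]]; exists (perm_mul k h); split=> //; exact: HM.
pose St := (T * T * list T)%type.
(* The lists are kept invariant under [H]. This puts [y n] outside [D n] along with [x n], and later
   yields surjectivity of the limit. *)
pose I (s : St) := forall z h, H h -> In z (snd s) -> In (pf h z) (snd s).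
pose R n (s s' : St) := let x := fst (fst s') in let y := snd (fst s') in
  (forall z, In z (snd s) -> In z (snd s')) /\ In (nu n) (snd s') /\
  In x (snd s') /\ In y (snd s') /\
  y <> x /\ orbit H x y /\
  forall z, orbit H x z -> exists h, H h /\ (forall a, In a (snd s) -> pf h a = a) /\ pf h x = z.
have [||sq [_ hsq]] := @dependent_choice St I R ((nu 0, nu 0), []).
- by [].
- move=> n [[x0 y0] D] hI; have [x [y [ney [oy tr]]]] := step D.
  have [D' hD'] : exists D', forall z, In z D' <-> (In z D \/ orbit H x z \/ orbit H (nu n) z).
    apply: finite_set_list; apply: finite_set_or; first by exists D.
    by apply: finite_set_or; [have [l [_ hl]] := hN x|have [l [_ hl]] := hN (nu n)]; exists l.
  exists (x, y, D'); split.
    move=> z h Hh /hD' hz; apply/hD'; case: hz => [hz|[hz|hz]].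
    + by left; apply: hI.
    + by right; left; apply: inv_orbit.
    + by right; right; apply: inv_orbit.
  split; first by move=> z hz; apply/hD'; left.
  split; first by apply/hD'; right; right.
  split; first by apply/hD'; right; left.
  by split; first by apply/hD'; right; left.
pose x n := fst (fst (sq (S n))); pose y n := snd (fst (sq (S n))); pose D n := snd (sq n).
have hI n : I (sq n) by apply: (proj1 (hsq n)).
have hR n : R n (sq n) (sq (S n)) by apply: (proj2 (hsq n)).
have Dinc n z : In z (D n) -> In z (D (S n)) by have [h _] := hR n; exact: h.
have Dmono n m z : n <= m -> In z (D n) -> In z (D m).
  by move=> le hz; elim: le => // m' _; exact: Dinc.
have nx n : ~ In (x n) (D n).
  move=> hx; have [_ [_ [_ [_ [ne [oy tr]]]]]] := hR n.
  have [h [_ [fh e]]] := tr _ oy; apply: ne; by rewrite -e; exact: fh.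
have ny n : ~ In (y n) (D n).
  move=> hy; have [_ [_ [_ [_ [_ [[h [Hh e]] _]]]]]] := hR n.
  apply: (nx n); have := hI n _ _ (HV _ Hh) hy; rewrite /y -e /= pinvK //.
pose p (q : nat * bool) := if snd q then y (fst q) else x (fst q).
have pin n b : In (p (n, b)) (D (S n)).
  by have [_ [_ [h1 [h2 _]]]] := hR n; case: b.
have pout n b : ~ In (p (n, b)) (D n) by case: b; [exact: ny|exact: nx].
have pI : injective p.
  move=> [i b] [j b'] e.
  have eij : i = j.
    case: (lt_eq_lt_dec i j) => [[lt|//]|lt].
      by case: (pout j b'); rewrite -e; apply: Dmono (pin i b).
    by case: (pout i b); rewrite e; apply: Dmono (pin j b').
  subst j; have [_ [_ [_ [_ [ne _]]]]] := hR i.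
  by case: b b' e => - [] //; rewrite /p /= => e; case: ne.
exists p; split=> // eps.
have [||g [_ hg]] := @dependent_choice (perm T) H (fun n g g' =>
   (forall z, In z (D n) -> pf g' z = pf g z) /\ pf g' (x n) = p (n, eps n)) (perm_id T).
- by [].
- move=> n g Hg; have [_ [_ [_ [_ [_ [oy tr]]]]]] := hR n.
  have op : orbit H (x n) (p (n, eps n)) by case: (eps n) => //; exact: orefl.
  (* The correction [h] acts before [g], so it must send [x n] to the preimage under [g] of the
     desired value. *)
  have [h [Hh [fh e]]] := tr _ (inv_orbit _ _ _ (HV _ Hg) op).
  exists (perm_mul h g); split; first exact: HM.
  split=> [z hz|] /=; first by rewrite fh.
  by rewrite e /= pfK.
have [|||||f [Gf hf]] := @limit_perm G g D clG.
- by move=> n; have [[]] := hg n.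
- exact: Dinc.
- by move=> n z hz; have [_ [h _]] := hg n; exact: h.
- move=> z; exists (S (idx z)); have [_ [h _]] := hR (idx z); by rewrite idxK in h.
- move=> z; exists (S (idx z)), (pinv (g (S (idx z))) z); split; last exact: pfK.
  apply: (hI (S (idx z)) _ (perm_inv _)); first by apply: HV; exact: (proj1 (hg _)).
  have [_ [h _]] := hR (idx z); by rewrite idxK in h.
exists f; split=> // i; have [_ [_ h]] := hg i.
by rewrite (hf (S i)) //; exact: (pin i false).
Qed.

(** * Galvin's theorem *)

(* A commutator trick: [W] lists the [g k] along the rows, [V] shifts the zeroth
   row, and only the zeroth row survives in the commutator of [V] with a translate
   of [W]. *)
Lemma finitely_generated_block (r : Z * Z * nat -> T) (g : nat -> perm T) :
  injective r ->
  (forall k x, (forall m, r (0%Z, 0%Z, m) <> x) -> pf (g k) x = x) ->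
  exists U, forall k, generated (fun h => In h U) (g k).
Proof.
move=> rI gfix; pose X := (Z * Z * nat)%type; pose r0 m := r (0%Z, 0%Z, m).
have img (h : perm T) : (forall x, (forall m, r0 m <> x) -> pf h x = x) ->
    forall m, exists m', pf h (r0 m) = r0 m'.
  move=> hfix m; apply: NNPP => none.
  have nI m' : r0 m' <> pf h (r0 m) by move=> e; apply: none; exists m'.
  by apply: (nI m); apply/esym/(@pf_inj _ h)/hfix.
have [psi hpsi] : exists psi : nat -> nat -> nat, forall k m, pf (g k) (r0 m) = r0 (psi k m).
  apply: (@choice_fun _ _ (fun k F => forall m, pf (g k) (r0 m) = r0 (F m))) => k.
  by apply: (@choice_fun _ _ (fun m m' => _ = r0 m')); apply: img; exact: gfix.
have [psi' hpsi'] : exists psi : nat -> nat -> nat, forall k m, pinv (g k) (r0 m) = r0 (psi k m).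
  apply: (@choice_fun _ _ (fun k F => forall m, pinv (g k) (r0 m) = r0 (F m))) => k.
  apply: (@choice_fun _ _ (fun m m' => _ = r0 m')); apply: (img (perm_inv (g k))) => x hx /=.
  by rewrite -{1}(gfix k x hx) pinvK.
have r0I m m' : r0 m = r0 m' -> m = m' by move=> /rI [].
have psiK k : cancel (psi k) (psi' k) by move=> m; apply: r0I; rewrite -hpsi' -hpsi pinvK.
have psi'K k : cancel (psi' k) (psi k) by move=> m; apply: r0I; rewrite -hpsi -hpsi' pfK.
(* In row [n >= 0] the permutation [g n] is repeated in all cells [c >= 0]. *)
pose row (f : nat -> nat -> nat) (q : X) : X := let '(n, c, m) := q in
  (n, c, if ((0 <=? n) && (0 <=? c))%Z%bool then f (Z.to_nat n) m else m).
have rowK : cancel (row psi) (row psi').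
  by move=> [[n c] m] /=; case: andb; rewrite ?psiK.
have rowK' : cancel (row psi') (row psi).
  by move=> [[n c] m] /=; case: andb; rewrite ?psi'K.
have [W [hW hW']] := extend_perm rI rowK rowK'.
pose tr d (q : X) : X := let '(n, c, m) := q in ((n + d)%Z, c, m).
have trK : cancel (tr 1%Z) (tr (-1)%Z).
  by move=> [[n c] m] /=; do 2 f_equal; lia.
have trK' : cancel (tr (-1)%Z) (tr 1%Z).
  by move=> [[n c] m] /=; do 2 f_equal; lia.
have [a [ha ha']] := extend_perm rI trK trK'.
pose sh d (q : X) : X := let '(n, c, m) := q in (n, (if (n =? 0)%Z then c + d else c)%Z, m).
have shK : cancel (sh 1%Z) (sh (-1)%Z).
  by move=> [[n c] m] /=; do 2 f_equal; case: (n =? 0)%Z; lia.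
have shK' : cancel (sh (-1)%Z) (sh 1%Z).
  by move=> [[n c] m] /=; do 2 f_equal; case: (n =? 0)%Z; lia.
have [V [hV hV']] := extend_perm rI shK shK'.
have pV q : pinv V (r q) = r (sh (-1)%Z q) by rewrite -{1}(shK' q) -hV pinvK.
have pV' x : (forall q, r q <> x) -> pinv V x = x.
  by move=> hx; rewrite -{1}(hV' x hx) pinvK.
exists [W; a; V] => k.
set Y := (Y in generated Y _).
have [b [gb [hb hb']]] : exists b, generated Y b /\
    (forall q, pf b (r q) = r (tr (Z.of_nat k) q)) /\ (forall x, (forall q, r q <> x) -> pf b x = x).
  elim: k => [|k [b [gb [hb hb']]]].
    exists (perm_id T); split; first exact: gen_id.
    by split=> // - [[n c] m] /=; rewrite Z.add_0_r.
  exists (perm_mul b a); split; first by apply: gen_mul => //; apply: gen_base; right; left.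
  split=> [[[n c] m]|x hx]; last by rewrite -[LHS]/(pf a (pf b x)) hb' // ha'.
  rewrite -[LHS]/(pf a (pf b _)) hb ha /=; do 3 f_equal; lia.
(* Translating by [k] brings [g k] to row 0. Shifting that row by one cell leaves a difference only
   at the cell [c = 0]. *)
pose Wk := conj_perm (perm_inv b) W.
have hWk n c m : pf Wk (r (n, c, m)) = r (n, c,
    if ((0 <=? n + Z.of_nat k) && (0 <=? c))%Z%bool then psi (Z.to_nat (n + Z.of_nat k)) m else m).
  rewrite -[LHS]/(pinv b (pf W (pf b _))) hb hW; apply: (@pf_inj _ b); by rewrite pfK hb.
have hWk' x : (forall q, r q <> x) -> pf Wk x = x.
  move=> hx; rewrite -[LHS]/(pinv b (pf W (pf b _))) hb' // hW' //.
  by apply: (@pf_inj _ b); rewrite pfK hb'.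
have gW : generated Y Wk.
  by apply: generated_conj; [exact: gen_inv|apply: gen_base; left].
clearbody Wk.
suff -> : g k = perm_mul Wk (conj_perm V (perm_inv Wk)).
  apply: gen_mul => //; apply: generated_conj; last exact: gen_inv.
  by apply: gen_base; right; right; left.
apply: perm_ext => x; rewrite -[RHS]/(pf V (pinv Wk (pinv V (pf Wk x)))).
suff -> : pinv V (pf Wk x) = pf Wk (pinv V (pf (g k) x)) by rewrite pinvK pfK.
case: (classic (exists q, r q = x)) => [[[[n c] m] <-]|hq]; last first.
  have hx : forall q, r q <> x by move=> q e; apply: hq; exists q.
  have -> : pf (g k) x = x by apply: gfix => m; exact: hx.
  by rewrite (hWk' x hx) (pV' x hx) (hWk' x hx).
case: (Z.eq_dec n 0) => [->|nn]; last first.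
  have -> : pf (g k) (r (n, c, m)) = r (n, c, m) by apply: gfix => m' /rI [] *; lia.
  have /Z.eqb_neq nn' := nn.
  by rewrite hWk !pV /= nn' hWk.
case: (Z.eq_dec c 0) => [->|nc].
  rewrite -[r (0%Z, 0%Z, m)]/(r0 m) hpsi /r0 hWk !pV /= hWk.
  have -> : (0 <=? 0 + Z.of_nat k)%Z = true by apply/Z.leb_le; lia.
  by rewrite Z.add_0_l Nat2Z.id.
have -> : pf (g k) (r (0%Z, c, m)) = r (0%Z, c, m) by apply: gfix => m' /rI [] *; lia.
rewrite hWk !pV /= hWk.
have -> // : (0 <=? c + -1)%Z = (0 <=? c)%Z.
by case: (Z.leb_spec 0 (c + -1)); case: (Z.leb_spec 0 c) => //; lia.
Qed.

(** The complement of [P] is carried onto one cell of a grid indexed by [Z * Z * nat]; [P] must be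
    infinite to make room for the other cells. *)
Lemma finitely_generated_fixing (P : T -> Prop) (g : nat -> perm T) :
  ~ finite_set P -> ~ finite_set (fun x => ~ P x) ->
  (forall k x, P x -> pf (g k) x = x) ->
  exists U, forall k, generated (fun h => In h U) (g k).
Proof.
move=> infP /enum_infinite [e [eI eP]] gfix.
pose zc (z : Z) := if (z <? 0)%Z then 2 * Z.abs_nat z + 1 else 2 * Z.abs_nat z.
have zcI (z z' : Z) : zc z = zc z' -> z = z'.
  by rewrite /zc; case: (Z.ltb_spec z 0); case: (Z.ltb_spec z' 0); lia.
pose r (q : Z * Z * nat) := nu (to_nat (zc (fst (fst q)), to_nat (zc (snd (fst q)), snd q))).
have rI : injective r.
  move=> [[n c] m] [[n' c'] m'] /(can_inj nuK) /(can_inj cancel_of_to).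
  move=> /pair_equal_spec [/zcI e1 /(can_inj cancel_of_to) /pair_equal_spec [/zcI e2 e3]].
  by rewrite /= in e1 e2 e3; rewrite e1 e2 e3.
pose r0 m := r (0%Z, 0%Z, m).
have [||||u hu] := @perm_extending _ r0 e.
- by move=> m m' /rI [].
- exact: eI.
- apply: (coinfinite_of_seq _ (e := fun n => r (1%Z, 0%Z, n))); first by move=> i j /rI [].
  by move=> n m /rI [].
- move=> [l hl]; apply: infP; exists l => x Px; apply: hl => n en.
  by have := proj2 (eP x) (ex_intro _ n en).
have [|U hU] := @finitely_generated_block r (fun k => conj_perm (perm_inv u) (g k)) rI.
  move=> k x hx; rewrite -[LHS]/(pinv u (pf (g k) (pf u x))).
  rewrite gfix ?pinvK //; apply: NNPP => /eP [n en].
  by apply: (hx n); apply: (@pf_inj _ u); rewrite -en -hu.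
exists (u :: U) => k; rewrite -(conj_permK u (g k)); apply: generated_conj.
  by apply: gen_base; left.
by apply: generated_mono (hU k) => h hh; right.
Qed.

Definition fixes_residue (i : nat) (h : perm T) : Prop :=
  forall x, idx x mod 3 = i -> pf h x = x.

Definition residue_fixer (h : perm T) : Prop := exists i, i < 3 /\ fixes_residue i h.

Lemma mod3 n i : i < 3 -> (3 * n + i) mod 3 = i.
Proof. by move=> lt; rewrite Nat.add_comm Nat.mul_comm Nat.Div0.mod_add Nat.mod_small. Qed.

Lemma residue_seq_inj i : injective (fun n => nu (3 * n + i)).
Proof. by move=> n m /(can_inj nuK); lia. Qed.

(** [P] meets some residue class [k] in an infinite set. A permutation [u] fixing class [j]
    pointwise carries this set onto class [k], with class [l] as spare room; conjugating [g] by [u]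
    gives a permutation fixing class [k]. *)
Lemma generated_fixing_infinite (P : T -> Prop) g : ~ finite_set P ->
  (forall x, P x -> pf g x = x) -> generated residue_fixer g.
Proof.
move=> infP gfix.
have [k [ltk infk]] : exists k, k < 3 /\ ~ finite_set (fun x => P x /\ idx x mod 3 = k).
  apply: NNPP => none; apply: infP.
  have fin k : k < 3 -> finite_set (fun x => P x /\ idx x mod 3 = k).
    by move=> lt; apply: NNPP => h; apply: none; exists k.
  have [l hl] := finite_set_or (fin 0 ltac:(lia)) (finite_set_or (fin 1 ltac:(lia)) (fin 2 ltac:(lia))).
  exists l => x Px; apply: hl.
  have := Nat.mod_upper_bound (idx x) 3 ltac:(lia).
  case: (idx x mod 3) => [|[|[|m]]] h; [by left|by right; left|by right; right|lia].
have [j [l [ltj [ltl [nkj [nkl njl]]]]]] :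
    exists j l, j < 3 /\ l < 3 /\ k <> j /\ k <> l /\ j <> l.
  by case: k ltk {infk} => [|[|[|k]]] ?; [exists 1, 2|exists 0, 2|exists 0, 1|]; lia.
have [e [eI eP]] := enum_infinite infk.
have em n : idx (e n) mod 3 = k by apply: (proj2 (proj2 (eP (e n)) (ex_intro _ n erefl))).
have ePn n : P (e n) by apply: (proj1 (proj2 (eP (e n)) (ex_intro _ n erefl))).
pose r (q : nat + nat) := match q with inl n => e n | inr n => nu (3 * n + j) end.
pose s (q : nat + nat) := match q with inl n => nu (3 * n + k) | inr n => nu (3 * n + j) end.
have mr q : idx (r q) mod 3 = match q with inl _ => k | inr _ => j end.
  by case: q => n; rewrite /r ?em // nuK mod3.
have ms q : idx (s q) mod 3 = match q with inl _ => k | inr _ => j end.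
  by case: q => n; rewrite /s nuK mod3.
have [||||u hu] := @perm_extending _ r s.
- move=> q q' E; have := f_equal (fun x => idx x mod 3) E; rewrite !mr.
  case: q E => n; case: q' => n' E; [by move/eI: E => ->|by move=> ?; lia|by move=> ?; lia|].
  by move/residue_seq_inj: E => ->.
- move=> q q' E; have := f_equal (fun x => idx x mod 3) E; rewrite !ms.
  by case: q E => n; case: q' => n' E; [|move=> ?; lia|move=> ?; lia|];
    move/residue_seq_inj: E => ->.
- apply: (coinfinite_of_seq _ (residue_seq_inj l)) => n q E.
  by have := mr q; rewrite E nuK mod3 //; case: q {E} => _; lia.
- apply: (coinfinite_of_seq _ (residue_seq_inj l)) => n q E.
  by have := ms q; rewrite E nuK mod3 //; case: q {E} => _; lia.
have resE x i : idx x mod 3 = i -> x = nu (3 * (idx x / 3) + i).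
  by move=> <-; rewrite -Nat.div_mod_eq idxK.
have gu : generated residue_fixer u.
  apply: gen_base; exists j; split=> // x /resE ->; exact: (hu (inr _)).
have -> : g = conj_perm (perm_inv u) (conj_perm u g).
  by apply: perm_ext => x /=; rewrite !pinvK.
apply: generated_conj; first exact: gen_inv.
apply: gen_base; exists k; split=> // x /resE ->.
by rewrite -[nu _]/(s (inl (idx x / 3))) -hu pf_conj /r gfix.
Qed.

(** Let [h] agree with [g] on a sequence [x] and fix a sequence [z]. Then both factors of
    [g = (g h^{-1}) h] fix infinitely many points. The points [w n] are left free so that [h]
    exists. *)
Lemma generated_residue_fixer g : generated residue_fixer g.
Proof.
pose O (d : T * T * T) := let '(x, z, w) := d in [x; pf g x; z; w].
pose good (d : T * T * T) (l : list T) := let '(x, z, w) := d in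
  (forall a, In a (O d) -> ~ In a l) /\
  z <> x /\ z <> pf g x /\ w <> x /\ w <> pf g x /\ w <> z.
have [||f [_ hf]] := @dependent_choice (list T) (fun _ => True)
    (fun _ l l' => exists d, l' = O d ++ l /\ good d l) [].
- by [].
- move=> _ l _.
  (* Avoiding the preimages of [l] too keeps [pf g x] out of [l]; it may still equal [x]. *)
  have [x [_ hx]] := infinite_avoid (l ++ map (pinv g) l) infinite_carrier.
  have [z [_ hz]] := infinite_avoid (x :: pf g x :: l) infinite_carrier.
  have [w [_ hw]] := infinite_avoid (z :: x :: pf g x :: l) infinite_carrier.
  exists (O (x, z, w) ++ l); split=> //; exists (x, z, w); split=> //=; split.
    move=> a [<-|[<-|[<-|[<-|//]]]] hl.
    + by apply: hx; apply/in_or_app; left.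
    + apply: hx; apply/in_or_app; right; rewrite -(pinvK g x); exact: in_map.
    + by apply: hz; right; right.
    + by apply: hw; right; right; right.
  split; first by move=> e; apply: hz; left.
  split; first by move=> e; apply: hz; right; left.
  split; first by move=> e; apply: hw; right; left.
  split; first by move=> e; apply: hw; right; right; left.
  by move=> e; apply: hw; left.
have [d hd] : exists d : nat -> T * T * T, forall n, f (S n) = O (d n) ++ f n /\ good (d n) (f n).
  apply: (@choice_fun _ _ (fun n d => f (S n) = O d ++ f n /\ good d (f n))) => n.
  exact: (proj2 (hf n)).
have Oin a i j : i < j -> In a (O (d i)) -> In a (f j).
  move=> lt ha; elim: lt => [|m _ IH]; rewrite (proj1 (hd _)); apply/in_or_app; [by left|by right].
have Oout a n : In a (O (d n)) -> ~ In a (f n).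
  by have [_] := hd n; rewrite /good; case: (d n) => [[x z] w] [h _]; exact: h.
have Odis a i j : In a (O (d i)) -> In a (O (d j)) -> i = j.
  move=> hi hj; case: (lt_eq_lt_dec i j) => [[lt|//]|lt].
    by case: (Oout a j hj); exact: Oin hi.
  by case: (Oout a i hi); exact: Oin hj.
pose x n := fst (fst (d n)); pose z n := snd (fst (d n)); pose w n := snd (d n).
have hO n : O (d n) = [x n; pf g (x n); z n; w n] by rewrite /x /z /w; case: (d n) => [[]].
have ne n : z n <> x n /\ z n <> pf g (x n) /\ w n <> x n /\ w n <> pf g (x n) /\ w n <> z n.
  by rewrite /x /z /w; have [_] := hd n; rewrite /good; case: (d n) => [[x' z'] w'] [].
have Ox n : In (x n) (O (d n)) by rewrite hO; left.
have Og n : In (pf g (x n)) (O (d n)) by rewrite hO; right; left.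
have Oz n : In (z n) (O (d n)) by rewrite hO; right; right; left.
have Ow n : In (w n) (O (d n)) by rewrite hO; do 3 right; left.
have clash a b i j : In a (O (d i)) -> In b (O (d j)) -> a = b -> i = j.
  by move=> hi hj e; apply: (Odis a) => //; rewrite e.
have xI : injective x by move=> i j; exact: clash (Ox i) (Ox j).
have zI : injective z by move=> i j; exact: clash (Oz i) (Oz j).
have wI : injective w by move=> i j; exact: clash (Ow i) (Ow j).
pose r (q : nat * bool) := if snd q then x (fst q) else z (fst q).
pose s (q : nat * bool) := if snd q then pf g (x (fst q)) else z (fst q).
have rO q : In (r q) (O (d (fst q))) by case: q => n []; [exact: Ox|exact: Oz].
have sO q : In (s q) (O (d (fst q))) by case: q => n []; [exact: Og|exact: Oz].
have [||||h hh] := @perm_extending _ r s.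
- move=> [i b] [j b'] e; have /= eij := clash _ _ _ _ (rO _) (rO _) e; subst j.
  have [h1 _] := ne i; case: b b' e => - [] //; rewrite /r /= => e; by case: h1.
- move=> [i b] [j b'] e; have /= eij := clash _ _ _ _ (sO _) (sO _) e; subst j.
  have [_ [h1 _]] := ne i; case: b b' e => - [] //; rewrite /s /= => e; by case: h1.
- apply: (coinfinite_of_seq _ wI) => n [i b] e.
  have /= eij := clash _ _ _ _ (rO _) (Ow _) e; subst i.
  by have [_ [_ [h1 [_ h2]]]] := ne n; case: b e; rewrite /r /= => e; [case: h1|case: h2].
- apply: (coinfinite_of_seq _ wI) => n [i b] e.
  have /= eij := clash _ _ _ _ (sO _) (Ow _) e; subst i.
  by have [_ [_ [_ [h1 h2]]]] := ne n; case: b e; rewrite /s /= => e; [case: h1|case: h2].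
have -> : g = perm_mul (perm_mul g (perm_inv h)) h.
  by apply: perm_ext => a /=; rewrite pfK.
apply: gen_mul.
  apply: (@generated_fixing_infinite (fun a => exists n, a = x n)).
    by apply: (infinite_of_seq xI) => n; exists n.
  by move=> a [n ->] /=; rewrite -[pf g (x n)]/(s (n, true)) -hh pinvK.
apply: (@generated_fixing_infinite (fun a => exists n, a = z n)).
  by apply: (infinite_of_seq zI) => n; exists n.
by move=> a [n ->]; exact: (hh (n, false)).
Qed.

Lemma generated_list (X : perm T -> Prop) g : generated X g ->
  exists l, (forall h, In h l -> X h) /\ generated (fun h => In h l) g.
Proof.
elim=> [f Xf||f1 f2 _ [l1 [h1 g1]] _ [l2 [h2 g2]]|f _ [l [h1 g1]]].
- exists [f]; split; [by move=> h [<-|[]]|by apply: gen_base; left].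
- by exists []; split=> //; exact: gen_id.
- exists (l1 ++ l2); split=> [h hh|].
    by case: (in_app_or _ _ _ hh) => [/h1|/h2].
  apply: gen_mul; [apply: generated_mono g1|apply: generated_mono g2] => h hh;
    apply/in_or_app; [by left|by right].
- by exists l; split=> //; exact: gen_inv.
Qed.

(* Galvin's theorem, without control on the number of generators. *)
Lemma countable_in_finitely_generated (s : nat -> perm T) :
  exists U, forall k, generated (fun h => In h U) (s k).
Proof.
have [L hL] : exists L : nat -> list (perm T), forall k,
    (forall h, In h (L k) -> residue_fixer h) /\ generated (fun h => In h (L k)) (s k).
  apply: (@choice_fun _ _ (fun k l => (forall h, In h l -> residue_fixer h) /\
    generated (fun h => In h l) (s k))) => k.
  exact/generated_list/generated_residue_fixer.
have part i : exists U, i < 3 -> forall k h, In h (L k) -> fixes_residue i h -> generated (fun h => In h U) h.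
  case: (le_lt_dec 3 i) => [le|lt]; first by exists []; lia.
  have [g hg] : exists g : nat -> perm T, forall n, fixes_residue i (g n) /\
      (let (k, j) := of_nat n in let h := nth j (L k) (perm_id T) in fixes_residue i h -> g n = h).
    apply: (@choice_fun _ _ (fun n f => fixes_residue i f /\
      (let (k, j) := of_nat n in let h := nth j (L k) (perm_id T) in fixes_residue i h -> f = h))) => n.
    case: (of_nat n) => k j; set h := nth j (L k) (perm_id T).
    case: (classic (fixes_residue i h)) => hi; [by exists h|by exists (perm_id T)].
  have [|||U hU] := @finitely_generated_fixing (fun x => idx x mod 3 = i) g.
  - by apply: (infinite_of_seq (residue_seq_inj i)) => n; rewrite nuK mod3.
  - apply: (infinite_of_seq (residue_seq_inj ((i + 1) mod 3))) => n.
    rewrite nuK mod3; first exact: Nat.mod_upper_bound.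
    by case: i lt {g hg} => [|[|[|i]]] //; lia.
  - by move=> k x hx; apply: (proj1 (hg k)).
  exists U => _ k h hin hi.
  have [j [_ hj]] := In_nth (L k) h (perm_id T) hin.
  have := proj2 (hg (to_nat (k, j))); rewrite cancel_of_to hj => /(_ hi) <-; exact: hU.
have [U0 h0] := part 0; have [U1 h1] := part 1; have [U2 h2] := part 2.
exists (U0 ++ U1 ++ U2) => k; have [Lf Lg] := hL k.
apply: generated_bind Lg => h hin.
have [[|[|[|i]]] [lt hi]] := Lf h hin; last lia.
- apply: generated_mono (h0 lt k h hin hi) => f hf; by apply/in_or_app; left.
- apply: generated_mono (h1 lt k h hin hi) => f hf.
  by apply/in_or_app; right; apply/in_or_app; left.
- apply: generated_mono (h2 lt k h hin hi) => f hf.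
  by apply/in_or_app; right; apply/in_or_app; right.
Qed.

Lemma preceq_ptwise_stab G (D : list T) : is_subgroup G -> preceq G (ptwise_stab G D).
Proof.
move=> sG; have [s [_ hs]] := coset_representatives D sG.
have [U hU] := countable_in_finitely_generated s.
exists U => g Gg; have [n hn] := hs g Gg.
have -> : g = perm_mul (perm_mul g (perm_inv (s n))) (s n).
  by apply: perm_ext => x /=; rewrite pfK.
apply: gen_mul; first by apply: gen_base; left.
by apply: generated_mono (hU n) => h hh; right.
Qed.

(** * Partitions *)

Lemma partition_preceq_pair_group (A : (T -> Prop) -> Prop) p0 :
  is_partition A -> bounded_partition A -> injective p0 -> coinfinite p0 ->
  preceq (stab_partition A) (pair_group p0).
Proof.
move=> [_ [Adis Acov]] [n hn] p0I p0C.
pose E x y := exists Sg, A Sg /\ Sg x /\ Sg y.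
have Ecl x Sg y : A Sg -> Sg x -> E x y -> Sg y.
  move=> AS Sx [Sg' [AS' [Sx' Sy']]].
  by rewrite (Adis _ _ AS AS') //; exists x.
apply: (preceq_trans (H := fun g => forall x, E x (pf g x))).
  apply: preceq_sub => g hg x; have [Sg [AS Sx]] := Acov x.
  by exists Sg; split=> //; split=> //; apply: (proj1 (hg Sg AS)).
apply: (@bounded_classes_preceq E n) => //.
- by move=> x y [Sg [AS [Sx Sy]]]; exists Sg.
- move=> x y z [Sg [AS [Sx Sy]]] h; exists Sg; split=> //; split=> //; exact: Ecl h.
- move=> x; have [Sg [AS Sx]] := Acov x.
  by apply: card_le_mono (hn Sg AS) => // y; exact: Ecl.
Qed.

Lemma bounded_orbits_preceq_pair_group G (D : list T) n p0 :
  is_subgroup G -> (forall x, card_le (orbit (ptwise_stab G D) x) n) ->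
  injective p0 -> coinfinite p0 -> preceq G (pair_group p0).
Proof.
move=> sG hn p0I p0C; apply: preceq_trans (preceq_ptwise_stab D sG) _.
have [_ [GM GV]] := sG; set H := ptwise_stab G D in hn *.
apply: (preceq_trans (H := fun g => forall x, orbit H x (pf g x))).
  by apply: preceq_sub => g Hg x; exists g.
apply: (@bounded_classes_preceq (orbit H) n) => //.
- move=> x y [h [[Gh fh] <-]]; exists (perm_inv h); split; last exact: pinvK.
  split; first exact: GV.
  by move=> a ha /=; rewrite -{1}(fh a ha) pinvK.
- move=> x y z [h [[Gh fh] <-]] [k [[Gk fk] <-]]; exists (perm_mul h k); split=> //.
  by split; [exact: GM|move=> a ha /=; rewrite fh // fk].
Qed.

Lemma closed_preceq_bounded_orbits G p0 : is_subgroup G -> closed_sub G -> injective p0 ->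
  preceq G (pair_group p0) ->
  exists (Gamma : list T) (n : nat), 0 < n /\
    forall x, card_le (orbit (ptwise_stab G Gamma) x) n.
Proof.
move=> sG cG p0I [U hU].
apply: (@closed_cover_bounded_orbits G (word (fun h => pair_group p0 h \/ In h U))
  (fun m => (2 + 2 * length U) ^ m)) => //.
  by apply: word_image_bound => x; exact: pair_group_image_bound.
by move=> g /hU; exact: generated_word.
Qed.

Lemma stab_partition_subgroup (B : (T -> Prop) -> Prop) : is_subgroup (stab_partition B).
Proof.
split; [|split].
- by move=> Sg _; split=> // y Sy; exists y.
- move=> f g hf hg Sg BS; have [f1 f2] := hf Sg BS; have [g1 g2] := hg Sg BS.
  split=> [x /f1 /g1 //|y /g2 [z [/f2 [x [Sx <-]] <-]]].
  by exists x.
- move=> f hf Sg BS; have [f1 f2] := hf Sg BS; split=> [x /f2 [y [Sy <-]]|y Sy] /=.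
    by rewrite pinvK.
  by exists (pf f y); split; [exact: f1|exact: pinvK].
Qed.

Lemma stab_partition_closed (B : (T -> Prop) -> Prop) : closed_sub (stab_partition B).
Proof.
move=> h hlim Sg BS; split=> [x Sx|y Sy].
  have [g [hg e]] := hlim [x]; rewrite -(e x (or_introl erefl)).
  exact: (proj1 (hg Sg BS)).
have [g [hg e]] := hlim [pinv h y].
have [x [Sx ex]] := proj2 (hg Sg BS) y Sy.
exists x; split=> //; suff -> : x = pinv h y by exact: pfK.
by apply: (@pf_inj _ g); rewrite ex (e _ (or_introl erefl)) pfK.
Qed.

Lemma bounded_partition_of_bounded_orbits (B : (T -> Prop) -> Prop) (D : list T) n :
  is_partition B -> (forall x, card_le (orbit (ptwise_stab (stab_partition B) D) x) n) ->
  bounded_partition B.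
Proof.
move=> [_ [Bdis _]] hn; exists (length D + n) => Sg BS.
case: (classic (exists x, Sg x /\ ~ In x D)) => [[x [Sx nx]]|none]; last first.
  exists D; split; [lia|move=> y Sy; apply: NNPP => ny; apply: none; by exists y].
have [l [ll hl]] := hn x.
exists (D ++ l); split; first by rewrite length_app; lia.
move=> y Sy; apply/in_or_app; case: (classic (In y D)) => ny; [by left|right].
apply: hl; case: (classic (y = x)) => [->|ne].
  exists (perm_id T); split=> //; split=> //.
  exact: (proj1 (stab_partition_subgroup B)).
pose r (b : bool) := if b then x else y.
have rI : injective r by move=> [] [] //= e; case: ne.
have nK : cancel negb negb by case.
have [t [h1 h2]] := extend_perm rI nK nK.
have tx : pf t x = y := h1 true; have ty : pf t y = x := h1 false.
have out z : z <> x -> z <> y -> pf t z = z.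
  by move=> zx zy; apply: h2 => - [] e; [apply: zx|apply: zy].
have tt z : pf t (pf t z) = z.
  case: (classic (z = x)) => [->|zx]; first by rewrite tx.
  by case: (classic (z = y)) => [->|zy]; [rewrite ty|rewrite !out].
have tS Sg' z : B Sg' -> Sg' z -> Sg' (pf t z).
  move=> BS' Sz; case: (classic (z = x)) => [e|zx].
    by rewrite e tx (Bdis _ _ BS' BS) //; exists x; split=> //; rewrite -e.
  case: (classic (z = y)) => [e|zy]; last by rewrite out.
  by rewrite e ty (Bdis _ _ BS' BS) //; exists y; split=> //; rewrite -e.
exists t; split=> //; split.
  move=> Sg' BS'; split=> [z|z Sz]; first exact: tS.
  by exists (pf t z); split; [exact: tS|].
by move=> z hz; apply: out => e; [apply: nx|apply: ny]; rewrite -e.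
Qed.

Lemma infinitely_many_nonsingletons (B : (T -> Prop) -> Prop) :
  (forall Sg, B Sg -> finite_set Sg) -> ~ bounded_partition B ->
  ~ finite_set (fun Sg => B Sg /\ card_gt1 Sg).
Proof.
move=> finB unb [l hl]; apply: unb.
have [n hn] : exists n, forall Sg, In Sg l -> B Sg -> card_le Sg n.
  elim: l {hl} => [|Sg0 l [n hn]]; first by exists 0.
  case: (classic (B Sg0)) => [/finB [k hk]|nB].
    exists (length k + n) => Sg [<- _|hSg BSg]; first by exists k; split; [lia|].
    by apply: card_le_mono (hn _ hSg BSg) => //; lia.
  exists n => Sg [<- //|]; exact: hn.
exists (S n) => Sg BSg; case: (classic (card_gt1 Sg)) => [gt|ngt].
  by apply: card_le_mono (hn Sg _ BSg) => //; [lia|apply: hl].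
case: (classic (exists x, Sg x)) => [[x Sx]|none]; last first.
  by exists []; split=> /= [|y Sy]; [lia|apply: none; exists y].
exists [x]; split=> /= [|y Sy]; first lia.
by left; apply: NNPP => ne; apply: ngt; exists x, y.
Qed.

End Countable.

Theorem theorem7p2 (Omega : Type) (HOm : countably_infinite Omega) :
  (forall A B : (Omega -> Prop) -> Prop, in_Q A -> in_Q B ->
     approx (stab_partition A) (stab_partition B)) /\
  (forall (G : perm Omega -> Prop), is_subgroup G -> closed_sub G ->
     forall A : (Omega -> Prop) -> Prop, in_Q A ->
     (approx G (stab_partition A) <->
        ((exists (Gamma : list Omega) (n : nat), 0 < n /\
            forall x, card_le (orbit (ptwise_stab G Gamma) x) n) /\
         ~ (exists Gamma : list Omega,
              forall g, ptwise_stab G Gamma g -> g = perm_id Omega)))) /\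
  (forall A B : (Omega -> Prop) -> Prop, in_Q A -> is_partition B ->
     (forall Sg, B Sg -> finite_set Sg) -> ~ bounded_partition B ->
     prec (stab_partition A) (stab_partition B)).
Proof.
have [nu [nuI /choice_fun [idx idxK]]] := HOm.
have nuK : cancel nu idx by move=> n; apply: nuI; rewrite idxK.
pose p0 (q : nat * bool) := nu (3 * fst q + Nat.b2n (snd q)).
have p0I : injective p0.
  move=> [i b] [j b'] /nuI /=; case: b; case: b' => /= e; try lia; f_equal; lia.
have p0C : coinfinite p0.
  apply: (coinfinite_of_seq _ (e := fun i => nu (3 * i + 2))); first by move=> i j /nuI; lia.
  by move=> i [j b] /nuI /=; case: b => /=; lia.
have above (C : (Omega -> Prop) -> Prop) : is_partition C ->
    ~ finite_set (fun Sg => C Sg /\ card_gt1 Sg) -> preceq (pair_group p0) (stab_partition C).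
  move=> pC infC; apply: (independent_moves_preceq nuK idxK) => //.
  exact: independent_moves_partition.
have below (C : (Omega -> Prop) -> Prop) : in_Q C -> preceq (stab_partition C) (pair_group p0).
  by move=> [pC [bC _]]; exact: (partition_preceq_pair_group nuK idxK).
have aboveQ (C : (Omega -> Prop) -> Prop) : in_Q C -> preceq (pair_group p0) (stab_partition C).
  by move=> [pC [_ iC]]; exact: above.
split; [|split].
- by move=> A B QA QB; split; apply: preceq_trans (below _ _) (aboveQ _ _).
- move=> G sG cG A QA; split.
    move=> [GA AG]; split.
      apply: (closed_preceq_bounded_orbits idxK sG cG p0I).
      exact: preceq_trans GA (below A QA).
    move=> [D triv]; apply: (pair_group_not_preceq_trivial_stab idxK sG p0I triv).
    exact: preceq_trans (aboveQ A QA) AG.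
  move=> [[D [n [_ hn]]] ntriv]; split.
    apply: preceq_trans (aboveQ A QA).
    exact: (bounded_orbits_preceq_pair_group nuK idxK sG hn).
  apply: preceq_trans (below A QA) _.
  apply: (independent_moves_preceq nuK idxK) => //.
  by apply: (independent_moves_closed idxK) => //; exists D, n.
- move=> A B QA pB finB unb; split.
    apply: preceq_trans (below A QA) (above B pB _).
    exact: infinitely_many_nonsingletons.
  move=> BA.
  have [D [n [_ hn]]] := closed_preceq_bounded_orbits idxK (stab_partition_subgroup B)
    (@stab_partition_closed _ B) p0I (preceq_trans BA (below A QA)).
  exact/unb/(bounded_partition_of_bounded_orbits pB hn).
Qed.
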